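(* Let $H:\mathbb{R}^d\times\mathbb{R}^d\to\mathbb{R}$, $(p,x)\mapsto H(p,x)$, be convex and Lipschitz continuous in $p$ and satisfy the standing assumptions listed in the context. Let $T>0$ and let $\xi:[0,T]\to\mathbb{R}$ be a continuous path with $\xi(0)=0$. Then $$S_H^{\xi}(0,T)=S_H^{R_{0,T}(\xi)}(0,T)$$ as operators on $BUC(\mathbb{R}^d)$.
   Context: $BUC(\mathbb{R}^d)$ is the space of bounded uniformly continuous real functions on $\mathbb{R}^d$; $\xi_{s,t}:=\xi(t)-\xi(s)$. Lipschitz continuity in $p$ is uniform in $x$. Standing assumption 1 (well-posedness). For each sign and every $u_0\in BUC(\mathbb{R}^d)$ the problem $u_t=\pm H(Du,x)$ in $\mathbb{R}^d\times(0,\infty)$, $u(\cdot,0)=u_0$, has a unique viscosity solution that is bounded and uniformly continuous on $\mathbb{R}^d\times[0,T]$ for every $T>0$. For $t\ge0$ write $S_{\pm H}(t)u_0:=u(\cdot,t)$, and for $t\le 0$ write $S_H(t):=S_{-H}(-t)$. Let $\ell(v,x)=\sup_{p\in\mathbb{R}^d}\{p\cdot v-H(p,x)\}\in(-\infty,+\infty]$ and, for $t>0$, let the minimal action be $$\mathcal{L}(x,y,t)=\inf\Big\{\int_0^t \ell(\dot\gamma(s),\gamma(s))\,ds:\ \gamma:[0,t]\to\mathbb{R}^d \text{ Lipschitz},\ \gamma(0)=x,\ \gamma(t)=y\Big\}.$$ It is recalled (classical) that $S_H(t)u_0(x)=\sup_{y}[u_0(y)-\mathcal{L}(x,y,t)]$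 and $S_{-H}(t)u_0(x)=\inf_{y}[u_0(y)+\mathcal{L}(y,x,t)]$ for $t>0$. Standing assumption 2. Either $H$ does not depend on $x$, or both of the following hold: for all $r>0$, $\limsup_{\delta\to0}\inf_{|x-y|\ge r}\mathcal{L}(x,y,\delta)=+\infty$; and $\lim_{\delta\to0}\lim_{r\to0}\sup_{|x-y|\le r}\mathcal{L}(x,y,\delta)=0$. Solution flow. If $\xi$ is continuous and affine on each interval of a partition $0=t_0\le\dots\le t_N=T$, put $S_H^\xi(0,T):=S_H(\xi_{t_{N-1},t_N})\circ\dots\circ S_H(\xi_{t_0,t_1})$. For general continuous $\xi$, $S_H^\xi(0,T)u_0:=\lim_n S_H^{\xi^n}(0,T)u_0$ (uniform limit on $\mathbb{R}^d$) for any continuous piecewise linear $\xi^n\to\xi$ uniformly on $[0,T]$; under the standing assumptions the limit exists and does not depend on the sequence. Reduced path. For continuous $\xi:[0,T]\to\mathbb{R}$ with $\xi(0)=0$ let $\tau_0:=\sup\{t\in[0,T]:\xi(t)=\max_{[0,T]}\xi \text{ or } \xi(t)=\min_{[0,T]}\xi\}$. Say $\tau_0$ is of maximum type if $\xi(\tau_0)=\max_{[0,T]}\xi$ and of minimum type if $\xi(\tau_0)=\min_{[0,T]}\xi$ (either choice if $\xi$ is constant). For $i\ge0$: if $\tau_i$ is of minimum type, $\tau_{i+1}:=\sup\arg\max_{[\tau_i,T]}\xi$, which is of maximum type; if $\tau_i$ is of maximum type, $\tau_{i+1}:=\sup\arg\min_{[\tau_i,T]}\xi$, which is of minimum type. For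 $i\le0$: if $\tau_i$ is of minimum type, $\tau_{i-1}:=\inf\arg\max_{[0,\tau_i]}\xi$, which is of maximum type; if $\tau_i$ is of maximum type, $\tau_{i-1}:=\inf\arg\min_{[0,\tau_i]}\xi$, which is of minimum type. Here $\arg\max_{[a,b]}\xi$, $\arg\min_{[a,b]}\xi$ are the sets of maximum and minimum points of $\xi$ on $[a,b]$. The reduced path $R_{0,T}(\xi)$ is the continuous path on $[0,T]$ that equals $\xi$ at $0$, at $T$ and at every $\tau_i$, $i\in\mathbb{Z}$, and is affine on each $[\tau_i,\tau_{i+1}]$. *)

(* Defs.v *)
From HB Require Import structures.
From mathcomp Require Import all_boot all_order all_algebra.
From mathcomp Require Import all_classical all_reals all_analysis.

Set Implicit Arguments.
Unset Strict Implicit.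
Unset Printing Implicit Defensive.

Import Order.TTheory GRing.Theory Num.Theory.
Import numFieldNormedType.Exports.
Local Open Scope classical_set_scope.
Local Open Scope ring_scope.

(* R^d is 'rV[R]_d with the library's sup norm.  All the notions below in
   which a norm occurs (uniform continuity, Lipschitz continuity, the
   conditions on the minimal action) are unchanged if that norm is replaced by
   the Euclidean one. *)

Section Solutions.
Context {R : realType} {d : nat}.
Implicit Types (G : 'rV[R]_d -> 'rV[R]_d -> R) (f : 'rV[R]_d -> R).
Implicit Types (u phi : 'rV[R]_d * R -> R).

Definition BUC_on {V : normedModType R} (A : set V) (f : V -> R) : Prop :=
  [bounded f z | z in A] /\
  forall e : R, 0 < e -> exists2 r : R, 0 < r &
    forall z w, A z -> A w -> `|z - w| < r -> `|f z - f w| < e.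

Definition BUC f : Prop := BUC_on [set: 'rV[R]_d] f.

Definition C1_on (U : set ('rV[R]_d * R)%type) phi : Prop :=
  forall z, U z -> differentiable phi z /\
    forall v, {for z, continuous (fun w => 'D_v phi w)}.

Definition space_gradient phi (z : 'rV[R]_d * R) : 'rV[R]_d :=
  \row_(i < d) 'D_((delta_mx 0 i : 'rV[R]_d), 0 : R) phi z.

Definition time_derivative phi (z : 'rV[R]_d * R) : R :=
  'D_((0 : 'rV[R]_d), 1 : R) phi z.

Definition positive_time : set ('rV[R]_d * R)%type := [set z | 0 < z.2].

(* A Hamiltonian takes the momentum first and the position second. *)
Definition viscosity_subsolution G u : Prop :=
  forall phi, C1_on positive_time phi -> forall z, positive_time z ->
    (\forall w \near z, u w - phi w <= u z - phi z) ->
    time_derivative phi z <= G (space_gradient phi z) z.1.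

Definition viscosity_supersolution G u : Prop :=
  forall phi, C1_on positive_time phi -> forall z, positive_time z ->
    (\forall w \near z, u w - phi w >= u z - phi z) ->
    time_derivative phi z >= G (space_gradient phi z) z.1.

(* The Cauchy problem u_t = G(Du, x), u(., 0) = u0; the values of u at
   negative times are irrelevant. *)
Definition cauchy_solution G (u0 : 'rV[R]_d -> R) u : Prop :=
  [/\ viscosity_subsolution G u, viscosity_supersolution G u,
      forall x, u (x, 0) = u0 x &
      forall T : R, 0 < T -> BUC_on [set z | 0 <= z.2 <= T] u].

Definition well_posed G : Prop :=
  forall u0 : 'rV[R]_d -> R, BUC u0 -> exists2 u, cauchy_solution G u0 u &
    forall v, cauchy_solution G u0 v ->
      forall x t, 0 <= t -> v (x, t) = u (x, t).

Definition oppH G : 'rV[R]_d -> 'rV[R]_d -> R := fun p x => - G p x.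

Definition forward_semigroup G (t : R) (u0 : 'rV[R]_d -> R) : 'rV[R]_d -> R :=
  fun x => xget (fun=> 0) [set u | cauchy_solution G u0 u] (x, t).

Definition semigroup G (t : R) (u0 : 'rV[R]_d -> R) : 'rV[R]_d -> R :=
  if 0 <= t then forward_semigroup G t u0
  else forward_semigroup (oppH G) (- t) u0.

End Solutions.

Section Action.
Context {R : realType} {d : nat}.
Implicit Types (H : 'rV[R]_d -> 'rV[R]_d -> R) (x y v : 'rV[R]_d).

Definition convex_in_p H : Prop :=
  forall x, convex_function [set: convex_lmodType 'rV[R]_d] (H^~ x).

Definition lipschitz_in_p H : Prop :=
  exists K : R, forall x p q, `|H p x - H q x| <= K * `|p - q|.

Definition independent_of_x H : Prop := forall p x y, H p x = H p y.

Definition lagrangian H v x : \bar R :=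
  ereal_sup [set (\sum_(i < d) p 0 i * v 0 i - H p x)%:E
            | p in [set: 'rV[R]_d]].

(* [derive1] is total; a Lipschitz curve is differentiable almost everywhere,
   so its value at the other times does not affect the integral. *)
Definition action H (t : R) (gamma : R -> 'rV[R]_d) : \bar R :=
  (\int[@lebesgue_measure R]_(s in `[0%R, t])
     lagrangian H (derive1 gamma s) (gamma s))%E.

Definition minimal_action H x y (t : R) : \bar R :=
  ereal_inf [set action H t gamma | gamma in
    [set gamma : R -> 'rV[R]_d |
      [/\ [lipschitz gamma s | s in `[0, t]], gamma 0 = x & gamma t = y]]].

Definition far_action H (r delta : R) : \bar R :=
  ereal_inf [set minimal_action H z.1 z.2 delta
            | z in [set z : 'rV[R]_d * 'rV[R]_d | r <= `|z.1 - z.2|]].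

Definition near_action H (r delta : R) : \bar R :=
  ereal_sup [set minimal_action H z.1 z.2 delta
            | z in [set z : 'rV[R]_d * 'rV[R]_d | `|z.1 - z.2| <= r]].

(* [near_action H r delta] is nondecreasing in r, so the inner limit exists. *)
Definition action_condition H : Prop :=
  (forall r : R, 0 < r -> limf_esup (far_action H r) (0 : R)^'+ = +oo%E) /\
  lim (near_action H r delta @[r --> (0 : R)^'+])
    @[delta --> (0 : R)^'+] --> (0 : \bar R).

(* The classical Lax-Oleinik (control) formulas for the semigroups of H
   and - H. *)
Definition lax_oleinik H : Prop :=
  forall (u0 : 'rV[R]_d -> R) (t : R) (x : 'rV[R]_d), BUC u0 -> 0 < t ->
    (semigroup H t u0 x)%:E =
      ereal_sup [set ((u0 y)%:E - minimal_action H x y t)%E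
                | y in [set: 'rV[R]_d]] /\
    (semigroup (oppH H) t u0 x)%:E =
      ereal_inf [set ((u0 y)%:E + minimal_action H y x t)%E
                | y in [set: 'rV[R]_d]].

End Action.

Section Flow.
Context {R : realType} {d : nat}.
Implicit Types (H : 'rV[R]_d -> 'rV[R]_d -> R).
Implicit Types (u w : 'rV[R]_d -> R).
Implicit Types (xi zeta : R -> R) (ts : seq R).

Definition affine_on (f : R -> R) (a b : R) : Prop :=
  exists c m : R, forall t, a <= t <= b -> f t = c + m * t.

(* The partition is t_0 = 0 followed by ts = [:: t_1; ...; t_N], t_N = T.
   Being affine on each of the closed intervals implies continuity. *)
Definition piecewise_affine (T : R) ts zeta : Prop :=
  [/\ path <=%R 0 ts, last 0 ts = T &
      forall i, (i < size ts)%N ->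
        affine_on zeta (nth 0 (0 :: ts) i) (nth 0 ts i)].

Fixpoint flow_along H zeta (s : R) ts u : 'rV[R]_d -> R :=
  if ts is t :: ts' then
    flow_along H zeta t ts' (semigroup H (zeta t - zeta s) u)
  else u.

(* Such a w is unique, because a continuous path is a uniform limit of
   piecewise affine ones. *)
Definition flow_limit H (T : R) xi u w : Prop :=
  {within `[0, T], continuous xi} /\
  forall (zeta : nat -> R -> R) (ts : nat -> seq R),
    (forall n, piecewise_affine T (ts n) (zeta n)) ->
    {uniform `[0, T], zeta @ \oo --> xi} ->
    {uniform, (fun n => flow_along H (zeta n) 0 (ts n) u) @ \oo --> w}.

Definition flow_defined H (T : R) xi u : Prop :=
  exists w, flow_limit H T xi u w.

Definition solution_flow H (T : R) xi u : 'rV[R]_d -> R :=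
  xget (fun=> 0) [set w | flow_limit H T xi u w].

End Flow.

Section ReducedPath.
Context {R : realType}.
Implicit Types (xi : R -> R) (T a b : R).

Definition argmax xi a b : set R :=
  [set t | a <= t <= b /\ forall s, a <= s <= b -> xi s <= xi t].

Definition argmin xi a b : set R :=
  [set t | a <= t <= b /\ forall s, a <= s <= b -> xi t <= xi s].

(* The times tau_i are computed together with their type: true for maximum
   type, false for minimum type.  For constant xi, tau_0 is given maximum
   type. *)
Definition tau_start T xi : bool * R :=
  let t := sup (argmax xi 0 T `|` argmin xi 0 T) in
  (`[< argmax xi 0 T t >], t).

Definition tau_next T xi (k : bool * R) : bool * R :=
  (~~ k.1, sup (if k.1 then argmin xi k.2 T else argmax xi k.2 T)).

Definition tau_prev xi (k : bool * R) : bool * R :=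
  (~~ k.1, inf (if k.1 then argmin xi 0 k.2 else argmax xi 0 k.2)).

Definition tau T xi (i : int) : R :=
  match i with
  | Posz n => (iter n (tau_next T xi) (tau_start T xi)).2
  | Negz n => (iter n.+1 (tau_prev xi) (tau_start T xi)).2
  end.

Definition chord xi a b t : R :=
  xi a + (t - a) / (b - a) * (xi b - xi a).

(* A time of [0, T] that lies in no [tau_i, tau_(i+1)[ is T, or an upper
   bound of all the tau_i, or smaller than all of them.  If tau_i increases to
   a limit s < T, then xi is constant on [s, T], and similarly near 0 when
   tau_i decreases to s > 0 as i tends to - oo.  Hence the continuous path
   prescribed by its values at 0, T and the tau_i agrees with xi at these
   times. *)
Definition reduced_path T xi : R -> R := fun t =>
  xget (xi t) [set y | exists i : int,
    tau T xi i <= t < tau T xi (i + 1) /\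
    y = chord xi (tau T xi i) (tau T xi (i + 1)) t].

End ReducedPath.

(* Main.v *)
Require Import Defs.
From HB Require Import structures.
From mathcomp Require Import all_boot all_order all_algebra.
From mathcomp Require Import all_classical all_reals all_analysis.
From mathcomp Require Import ring lra.
Import Order.TTheory GRing.Theory Num.Theory.
Import numFieldNormedType.Exports.
Set Implicit Arguments.
Unset Strict Implicit.
Unset Printing Implicit Defensive.
Local Open Scope classical_set_scope.
Local Open Scope ring_scope.

(** Write S_t for the operator attached to an increment t of the path, of
    either sign. By the Lax-Oleinik formulas S_t is monotone and nonexpansive,
    and for t >= 0 the operators S_t and S_(-t) are adjoint,
      S_t S_(-t) <= id <= S_(-t) S_t.
    Increments of the same sign add up, because a time translate of a solution
    is a solution and solutions are unique. Together these give
    S_s S_(-t) <= S_(s-t) for s, t >= 0, and hence a comparison of flows along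
    two paths (flow_sandwich): if zeta <= eta + c, then going down from eta + c
    to zeta, following zeta and climbing back to eta + c gives at most the flow
    along eta.

    Comparison with constant paths shows that the flow along a path which stays
    between the values at its two ends is S_t for the total increment t
    (flow_from_min_to_max, flow_from_max_to_min). The path xi has this property
    on every interval between consecutive times tau_i, so there it may be
    replaced by its chord.

    Comparison of two paths at distance at most delta bounds the difference of
    their flows by a quantity that depends on delta and on the datum only
    (flow_stable), provided that a small positive increment cannot lower the
    functions produced by the flows by much (flow_le_semigroup). This is where
    the condition on the minimal action enters: either staying at a point is
    cheap, or H does not depend on x, and then translation invariance provides
    a common modulus of continuity. Stability yields the existence of the limit
    along every continuous path.

    It remains to approximate xi and its reduced path simultaneously by
    piecewise affine paths with the same flow (coupled_reduced_path). The
    oscillation of xi before tau_(-m) and after tau_n tends to 0, so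
    interpolating xi at 0, tau_(-m), ..., tau_n, T approximates the reduced
    path, and interpolating it at a fine refinement of these nodes approximates
    xi. *)

(** * Time translation of viscosity solutions *)

Section TimeShift.
Context {R : realType}.

Definition pospart_sqr (y : R) : R := (Num.max y 0) ^+ 2.

Lemma is_derive_pospart_sqr (y : R) : is_derive y 1 pospart_sqr (2 * Num.max y 0).
Proof.
have H : (fun h : R => h^-1 *: (pospart_sqr (h *: (1 : R) + y) - pospart_sqr y)) h @[h --> 0^']
    --> 2 * Num.max y 0.
  apply/cvgrPdist_le => e e0; near=> h.
  have h0 : h != 0 by near: h; exact: nbhs_dnbhs_neq.
  have E : `|pospart_sqr (h + y) - pospart_sqr y - 2 * Num.max y 0 * h| <= `|h| ^+ 2.
    rewrite real_normK ?num_real// ler_norml /pospart_sqr.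
    by apply/andP; case: (leP y 0); case: (leP (h + y) 0); nra.
  have -> : 2 * Num.max y 0 - h^-1 *: (pospart_sqr (h *: 1 + y) - pospart_sqr y) =
      - (h^-1 * (pospart_sqr (h + y) - pospart_sqr y - 2 * Num.max y 0 * h)).
    by rewrite /GRing.scale/= mulr1; field.
  rewrite normrN normrM normfV ler_pdivrMl ?normr_gt0// (le_trans E)// expr2.
  rewrite ler_wpM2l//; near: h; apply: dnbhs0_le => //.
have D : derivable pospart_sqr y 1 by apply/cvg_ex; exists (2 * Num.max y 0).
split => //; apply/cvg_lim => //.
Unshelve. all: by end_near. Qed.

Lemma continuous_pospart_sqr_slope : continuous (fun y : R => 2 * Num.max y 0).
Proof.
move=> y; apply: cvgM; first exact: cvg_cst.
by apply: continuous_max; [exact: cvg_id | exact: cvg_cst].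
Qed.

(** The change of time [t |-> t - s] sends small positive times to negative ones, so
    it cannot transport a test function that is given at positive times only.
    This one coincides with it for t >= s + t0 / 2, in particular near t0 + s,
    and the quadratic correction keeps it positive and of class C1. *)
Definition retime (s t0 t : R) : R := t - s + t0^-1 * pospart_sqr (s + t0 / 2 - t).

Definition retime_slope (s t0 t : R) : R := 1 - t0^-1 * (2 * Num.max (s + t0 / 2 - t) 0).

Lemma is_derive_retime (s t0 t : R) : is_derive t 1 (retime s t0) (retime_slope s t0 t).
Proof.
have Hp := is_derive_pospart_sqr (s + t0 / 2 - t).
have Hd : is_derive t 1 (cst (s + t0 / 2) - id) (-1).
  by apply: is_derive_eq; rewrite sub0r.
have Hc := @is_derive1_comp _ pospart_sqr (cst (s + t0 / 2) - id) t _ _ Hp Hd.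
have -> : retime s t0 = id - cst s + t0^-1 *: (pospart_sqr \o (cst (s + t0 / 2) - id)).
  by [].
apply: is_derive_eq.
by rewrite /retime_slope /GRing.scale/=; lra.
Qed.

Lemma retime_gt0 (s t0 t : R) : 0 <= s -> 0 < t0 -> 0 < t -> 0 < retime s t0 t.
Proof.
move=> s0 t00 t_gt0; rewrite /retime /pospart_sqr.
have [h|h] := leP (s + t0 / 2 - t) 0.
  by rewrite expr2 mulr0 mulr0; lra.
rewrite -(pmulr_rgt0 _ t00) mulrDr mulrA mulfV ?gt_eqF// mul1r.
have := sqr_ge0 (t - s); have := mulr_gt0 t00 t00.
set a := t - s; set y := s + t0 / 2 - t.
have -> : a = t0 / 2 - y by rewrite /a /y; lra.
rewrite !expr2; nra.
Qed.

Lemma retime_shift (s t0 : R) : 0 < t0 ->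
  forall t, s + t0 / 2 <= t -> retime s t0 t = t - s.
Proof.
move=> t00 t ht; rewrite /retime /pospart_sqr.
have -> : Num.max (s + t0 / 2 - t) 0 = 0 by apply/max_idPr; lra.
by rewrite expr0n/= mulr0 addr0.
Qed.

Lemma continuous_retime_slope (s t0 : R) : continuous (retime_slope s t0).
Proof.
move=> t; rewrite /retime_slope.
apply: cvgB; first exact: cvg_cst.
apply: cvgM; first exact: cvg_cst.
apply: (@continuous_comp _ _ _ (fun t => s + t0 / 2 - t) (fun y => 2 * Num.max y 0)).
  by apply: cvgB; [exact: cvg_cst | exact: cvg_id].
exact: continuous_pospart_sqr_slope.
Qed.

Context {d : nat}.
Notation V := ('rV[R]_d * R)%type.

Definition retimed (s t0 : R) (z : V) : V := (z.1, retime s t0 z.2).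

Lemma is_diff_retimed (s t0 : R) (z : V) :
  is_diff z (retimed s t0) (fun v : V => (v.1, v.2 * retime_slope s t0 z.2)).
Proof.
have Hf : is_diff z (@fst 'rV[R]_d R) (@fst 'rV[R]_d R).
  split; first by apply: linear_differentiable => w; exact: cvg_fst.
  by rewrite diff_lin// => w; exact: cvg_fst.
have Hs : is_diff z (@snd 'rV[R]_d R) (@snd 'rV[R]_d R).
  split; first by apply: linear_differentiable => w; exact: cvg_snd.
  by rewrite diff_lin// => w; exact: cvg_snd.
have Hr : is_diff (z.2) (retime s t0) (fun h => h * retime_slope s t0 z.2).
  have [Hd Hv] := is_derive_retime s t0 z.2.
  split; first exact/derivable1_diffP.
  by rewrite deriv1E// derive1E Hv.
have Hc := is_diff_comp Hs Hr.
exact: (is_diff_pair Hf Hc).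
Qed.

Section Test.
Variables (s t0 : R) (phi : V -> R).
Hypotheses (s_ge0 : 0 <= s) (t0_gt0 : 0 < t0) (phiC1 : C1_on positive_time phi).

Let pos_retimed z : positive_time z -> positive_time (retimed s t0 z).
Proof. by move=> z0; exact: retime_gt0. Qed.

Lemma derive_retimed (z v : V) : positive_time z ->
  'D_v (phi \o retimed s t0) z =
  'D_((v.1, 0) : V) phi (retimed s t0 z) +
  v.2 * retime_slope s t0 z.2 * 'D_((0, 1) : V) phi (retimed s t0 z).
Proof.
move=> z0.
have [Dphi _] := phiC1 (pos_retimed z0).
have [DT VT] := is_diff_retimed s t0 z.
rewrite deriveE; last exact: differentiable_comp.
rewrite diff_comp//= VT !deriveE//.
set L := 'd phi _.
have -> : (v.1, v.2 * retime_slope s t0 z.2) =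
    (v.1, 0) + (v.2 * retime_slope s t0 z.2) *: ((0, 1) : V) :> V.
  congr pair => /=; first by rewrite scaler0 addr0.
  by rewrite add0r /GRing.scale/= mulr1.
by rewrite linearD linearZ.
Qed.

Lemma C1_retimed : C1_on positive_time (phi \o retimed s t0).
Proof.
move=> z z0.
have [Dphi Cphi] := phiC1 (pos_retimed z0).
have [DT VT] := is_diff_retimed s t0 z.
split; first exact: differentiable_comp.
move=> v.
have cT := differentiable_continuous DT.
have Hn : \forall w \near z,
   'D_((v.1, 0) : V) phi (retimed s t0 w) +
   v.2 * retime_slope s t0 w.2 * 'D_((0, 1) : V) phi (retimed s t0 w) =
   'D_v (phi \o retimed s t0) w.
  have : \forall w \near z, 0 < w.2.
    have /cvgr_gt : snd @ nbhs z --> z.2 by exact: cvg_snd.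
    exact.
  by apply: filterS => w w0; rewrite derive_retimed.
suff : (fun w => 'D_v (phi \o retimed s t0) w) @ z -->
    'D_((v.1, 0) : V) phi (retimed s t0 z) +
    v.2 * retime_slope s t0 z.2 * 'D_((0, 1) : V) phi (retimed s t0 z).
  by rewrite -derive_retimed.
apply: cvg_trans; first exact: near_eq_cvg Hn.
apply: cvgD.
  exact: (@cvg_comp _ _ _ (retimed s t0)
    (fun w => 'D_((v.1, 0) : V) phi w) _ _ _ cT (Cphi (v.1, 0))).
apply: cvgM; last first.
  exact: (@cvg_comp _ _ _ (retimed s t0)
    (fun w => 'D_((0, 1) : V) phi w) _ _ _ cT (Cphi (0, 1))).
apply: cvgM; first exact: cvg_cst.
apply: (@cvg_comp _ _ _ snd (retime_slope s t0) _ (nbhs z.2)).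
  exact: cvg_snd.
exact: continuous_retime_slope.
Qed.

End Test.
Lemma retime_slope_eq1 (s t0 : R) : 0 < t0 -> retime_slope s t0 (t0 + s) = 1.
Proof.
move=> t0_gt0; rewrite /retime_slope.
have -> : Num.max (s + t0 / 2 - (t0 + s)) 0 = 0 by apply/max_idPr; lra.
by rewrite !mulr0 subr0.
Qed.

Lemma retimed_eq (s : R) (z : V) : 0 < z.2 ->
  retimed s z.2 (z.1, z.2 + s) = z.
Proof.
by move=> z0; rewrite /retimed retime_shift//=; [case: z {z0} => x t /=; congr pair|]; lra.
Qed.

Lemma near_retimed (s : R) (z : V) (Q : V -> Prop) : 0 < z.2 ->
  (\forall w \near z, Q w) ->
  \forall w \near (z.1, z.2 + s),
    Q (retimed s z.2 w) /\ w = ((retimed s z.2 w).1, (retimed s z.2 w).2 + s).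
Proof.
move=> z0 HQ.
have cT := differentiable_continuous (@ex_diff _ _ _ _ _ _ _ (is_diff_retimed s z.2 (z.1, z.2 + s))).
have H1 : \forall w \near (z.1, z.2 + s), Q (retimed s z.2 w).
  by apply: cT; rewrite retimed_eq.
have H2 : \forall w \near (z.1, z.2 + s), s + z.2 / 2 < w.2.
  have /cvgr_gt : snd @ nbhs ((z.1, z.2 + s) : V) --> z.2 + s by exact: cvg_snd.
  apply; lra.
apply: filterS2 H1 H2 => w Qw hw; split=> //.
rewrite /retimed retime_shift//=; last exact: ltW.
by rewrite subrK; case: (w).
Qed.

Lemma space_gradient_retimed (s : R) (phi : V -> R) (z : V) :
    0 <= s -> positive_time z -> C1_on positive_time phi ->
  space_gradient (phi \o retimed s z.2) (z.1, z.2 + s) = space_gradient phi z.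
Proof.
move=> s0 z0 phiC1; apply/rowP => i; rewrite !mxE.
rewrite derive_retimed//=; last by rewrite /positive_time/= ltr_wpDr.
by rewrite retimed_eq// !mul0r addr0.
Qed.

Lemma time_derivative_retimed (s : R) (phi : V -> R) (z : V) :
    0 <= s -> positive_time z -> C1_on positive_time phi ->
  time_derivative (phi \o retimed s z.2) (z.1, z.2 + s) = time_derivative phi z.
Proof.
move=> s0 z0 phiC1; rewrite /time_derivative.
rewrite derive_retimed//=; last by rewrite /positive_time/= ltr_wpDr.
rewrite retimed_eq// retime_slope_eq1// !mul1r.
have -> : ((0, 0) : V) = 0 by [].
by rewrite derive0 add0r.
Qed.

(** The maximum and minimum conditions are local and the test functions are
    retimed without any change near the contact point, so translating a
    solution in time leaves both viscosity inequalities intact. *)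
Lemma cauchy_solution_shift (G : 'rV[R]_d -> 'rV[R]_d -> R) u0 u (s : R) :
  0 <= s -> cauchy_solution G u0 u ->
  cauchy_solution G (fun x => u (x, s)) (fun z => u (z.1, z.2 + s)).
Proof.
move=> s0 [usub usup u_0 uBUC].
have pos (z : V) : positive_time z -> positive_time (z.1, z.2 + s) by
  move=> z0; rewrite /positive_time/= ltr_wpDr.
split.
- move=> phi phiC1 z z0 zmax.
  have := usub _ (C1_retimed s0 z0 phiC1) _ (pos _ z0).
  rewrite time_derivative_retimed// space_gradient_retimed//; apply.
  apply: filterS (near_retimed s z0 zmax) => w [Hw wE].
  by rewrite /= retimed_eq//; rewrite {1}wE.
- move=> phi phiC1 z z0 zmin.
  have := usup _ (C1_retimed s0 z0 phiC1) _ (pos _ z0).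
  rewrite time_derivative_retimed// space_gradient_retimed//; apply.
  apply: filterS (near_retimed s z0 zmin) => w [Hw wE].
  by rewrite /= retimed_eq//; rewrite {1}wE.
- by move=> x; rewrite add0r.
- move=> T T0.
  have [bu cu] := uBUC (T + s) (ltr_wpDr s0 T0).
  have ins (z : V) : 0 <= z.2 <= T -> 0 <= z.2 + s <= T + s.
    by move=> /andP[? ?]; rewrite addr_ge0// lerD2r.
  split.
    have [M [Mr HM]] := bu; exists M; split=> // x /HM H z /= zT.
    exact: (H (z.1, z.2 + s) (ins z zT)).
  move=> e e0; have [r r0 Hr] := cu _ e0; exists r => // z w zT wT zw.
  apply: Hr; [exact: ins | exact: ins |].
  by have -> : (z.1, z.2 + s) - (w.1, w.2 + s) = z - w :> V
    by congr pair; rewrite /=; lra.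
Qed.

End TimeShift.

(** * The semigroups of H and - H *)

Section Forward.
Context {R : realType} {d : nat}.
Variable G : 'rV[R]_d -> 'rV[R]_d -> R.
Hypothesis G_well_posed : well_posed G.
Implicit Types (u : 'rV[R]_d -> R).

Lemma forward_semigroup_spec u : BUC u -> exists2 w, cauchy_solution G u w &
  forall x t, forward_semigroup G t u x = w (x, t).
Proof.
move=> /G_well_posed[w wsol _].
exists (xget (fun=> 0) [set w | cauchy_solution G u w]) => //.
by apply: (@xgetPex _ (fun=> 0) [set w | cauchy_solution G u w]); exists w.
Qed.

Lemma forward_semigroup_unique u w : BUC u -> cauchy_solution G u w ->
  forall x t, 0 <= t -> forward_semigroup G t u x = w (x, t).
Proof.
move=> uB wsol x t t0; have [v vsol ->] := forward_semigroup_spec uB.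
have [z _ zuniq] := G_well_posed uB.
by rewrite !zuniq.
Qed.

Lemma BUC_forward_semigroup u t : 0 <= t -> BUC u -> BUC (forward_semigroup G t u).
Proof.
move=> t0 uB; have [w [_ _ _ wB] wE] := forward_semigroup_spec uB.
have [bw cw] := wB _ (ltr_wpDl t0 ltr01).
have ins (x : 'rV[R]_d) : 0 <= (x, t).2 <= t + 1 by rewrite /= t0 lerDl ler01.
split.
  have [M [Mr HM]] := bw; exists M; split=> // x /HM H z _ /=.
  by rewrite wE; exact: (H (z, t) (ins z)).
move=> e /cw[r r0 Hr]; exists r => // x y _ _ xy; rewrite !wE.
apply: Hr; [exact: ins | exact: ins |].
rewrite (_ : _ - _ = (x - y, 0) :> 'rV[R]_d * R); last first.
  by congr pair; rewrite /= subrr.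
by rewrite prod_normE/= normr0 gt_max xy.
Qed.

Lemma forward_semigroup0 u : BUC u -> forward_semigroup G 0 u = u.
Proof.
move=> uB; have [w [_ _ w0 _] wE] := forward_semigroup_spec uB.
by apply/funext => x; rewrite wE w0.
Qed.

(** A time translate of the solution solves the equation from the translated
   datum, and solutions are unique. *)
Lemma forward_semigroupD u s t : 0 <= s -> 0 <= t -> BUC u ->
  forward_semigroup G (s + t) u = forward_semigroup G s (forward_semigroup G t u).
Proof.
move=> s0 t0 uB; have [w wsol wE] := forward_semigroup_spec uB.
apply/funext => x; rewrite wE.
have := cauchy_solution_shift t0 wsol.
rewrite -[X in cauchy_solution _ X](_ : forward_semigroup G t u = _); last first.
  by apply/funext => y; rewrite wE.
move=> /forward_semigroup_unique -> //=.
exact: BUC_forward_semigroup.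
Qed.

Lemma forward_semigroup_cont u e : BUC u -> 0 < e -> exists2 r : R, 0 < r &
  forall t x, 0 <= t < r -> `|forward_semigroup G t u x - u x| <= e.
Proof.
move=> uB e0; have [w [_ _ w0 wB] wE] := forward_semigroup_spec uB.
have [_ /(_ _ e0)[r r0 Hr]] := wB 1 ltr01.
exists (Num.min r 1) => [|t x]; first by rewrite lt_min r0 ltr01.
rewrite lt_min => /andP[t0 /andP[tr t1]].
rewrite wE -w0; apply/ltW/Hr => /=.
- by rewrite t0 ltW.
- by rewrite lexx ler01.
rewrite (_ : _ - _ = (0, t) :> 'rV[R]_d * R); last first.
  by congr pair; rewrite /= ?subrr ?subr0.
by rewrite prod_normE/= normr0 gt_max r0 ger0_norm.
Qed.

End Forward.

Section Semigroup.
Context {R : realType} {d : nat}.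
Variable H : 'rV[R]_d -> 'rV[R]_d -> R.
Hypothesis H_well_posed : well_posed H /\ well_posed (oppH H).
Hypothesis H_lax_oleinik : lax_oleinik H.
Implicit Types (u v : 'rV[R]_d -> R) (x y : 'rV[R]_d) (t : R).

Notation S := (semigroup H).
Notation L := (minimal_action H).

Lemma semigroup_ge0 t u : 0 <= t -> S t u = forward_semigroup H t u.
Proof. by rewrite /semigroup => ->. Qed.

Lemma semigroup_opp t u : 0 <= t -> BUC u ->
  S (- t) u = forward_semigroup (oppH H) t u.
Proof.
rewrite le0r => /orP[/eqP ->|t0] uB.
  by rewrite oppr0 semigroup_ge0// !forward_semigroup0//; case: H_well_posed.
by rewrite /semigroup leNgt oppr_lt0 t0/= opprK.
Qed.

Lemma semigroup_le0 t u : t <= 0 -> BUC u ->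
  S t u = forward_semigroup (oppH H) (- t) u.
Proof. by move=> t0 uB; rewrite -semigroup_opp ?opprK ?oppr_ge0. Qed.

Lemma BUC_semigroup t u : BUC u -> BUC (S t u).
Proof.
move=> uB; have [wp wpN] := H_well_posed.
have [t0|/ltW t0] := leP 0 t.
  by rewrite semigroup_ge0//; exact: BUC_forward_semigroup.
by rewrite semigroup_le0//; apply: BUC_forward_semigroup; rewrite ?oppr_ge0.
Qed.

Lemma semigroup0 u : BUC u -> S 0 u = u.
Proof. by move=> uB; rewrite semigroup_ge0// forward_semigroup0//; case: H_well_posed. Qed.

Lemma semigroupD_ge0 s t u : 0 <= s -> 0 <= t -> BUC u ->
  S (s + t) u = S s (S t u).
Proof.
move=> s0 t0 uB; rewrite !semigroup_ge0 ?addr_ge0// forward_semigroupD//.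
by case: H_well_posed.
Qed.

Lemma semigroupD_le0 s t u : s <= 0 -> t <= 0 -> BUC u ->
  S (s + t) u = S s (S t u).
Proof.
move=> s0 t0 uB; have tB := BUC_semigroup t uB.
have st0 : s + t <= 0 by lra.
rewrite (semigroup_le0 s0 tB) (semigroup_le0 t0 uB) (semigroup_le0 st0 uB).
have [_ wpN] := H_well_posed.
by rewrite opprD (forward_semigroupD wpN) ?oppr_ge0.
Qed.

Lemma semigroup_cont u e : BUC u -> 0 < e -> exists2 r : R, 0 < r &
  forall t x, `|t| < r -> `|S t u x - u x| <= e.
Proof.
move=> uB e0; have [wp wpN] := H_well_posed.
have [r r0 Hr] := forward_semigroup_cont wp uB e0.
have [q q0 Hq] := forward_semigroup_cont wpN uB e0.
exists (Num.min r q) => [|t x]; first by rewrite lt_min r0.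
rewrite lt_min => /andP[tr tq].
have [t0|/ltW t0] := leP 0 t.
  by rewrite semigroup_ge0//; apply: Hr; rewrite t0 -(ger0_norm t0).
by rewrite semigroup_le0//; apply: Hq; rewrite oppr_ge0 t0 -(ler0_norm t0).
Qed.

Lemma oleinik_sup_ub t u x y : 0 < t -> BUC u ->
  ((u y)%:E - L x y t <= (S t u x)%:E)%E.
Proof.
move=> t0 uB; have [-> _] := H_lax_oleinik x uB t0.
by apply: ereal_sup_ubound; exists y.
Qed.

Lemma oleinik_sup_le t u x c : 0 < t -> BUC u ->
  (forall y, ((u y)%:E - L x y t <= c%:E)%E) -> S t u x <= c.
Proof.
move=> t0 uB Hc; rewrite -lee_fin; have [-> _] := H_lax_oleinik x uB t0.
by apply: ge_ereal_sup => _ [y _ <-].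
Qed.

Lemma semigroupN t u : 0 < t -> BUC u -> S (- t) u = semigroup (oppH H) t u.
Proof.
by move=> t0 uB; rewrite semigroup_opp ?ltW// [RHS]/semigroup ltW.
Qed.

Lemma oleinik_inf_lb t u x y : 0 < t -> BUC u ->
  ((S (- t) u x)%:E <= (u y)%:E + L y x t)%E.
Proof.
move=> t0 uB; rewrite semigroupN//; have [_ ->] := H_lax_oleinik x uB t0.
by apply: ereal_inf_lbound; exists y.
Qed.

Lemma oleinik_inf_ge t u x c : 0 < t -> BUC u ->
  (forall y, (c%:E <= (u y)%:E + L y x t)%E) -> c <= S (- t) u x.
Proof.
move=> t0 uB Hc; rewrite -lee_fin semigroupN//.
have [_ ->] := H_lax_oleinik x uB t0.
by apply: le_ereal_inf_tmp => _ [y _ <-].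
Qed.

(** Both Lax-Oleinik formulas are monotone in the datum and commute with the
    addition of constants; hence each operator is nonexpansive for the
    supremum norm. *)
Lemma semigroup_le_shift t u v c : BUC u -> BUC v ->
  (forall x, u x <= v x + c) -> forall x, S t u x <= S t v x + c.
Proof.
move=> uB vB uv x.
have [t0|t0|<-] := ltgtP 0 t; last by rewrite !semigroup0.
- apply: oleinik_sup_le => // y.
  have := oleinik_sup_ub x y t0 vB; have := uv y.
  by case: (L x y t) => [l| |]//=; rewrite ?leNye// !lee_fin; lra.
- rewrite -(opprK t) -lerBlDr; have t0' : 0 < - t by rewrite oppr_gt0.
  apply: oleinik_inf_ge => // y.
  have := oleinik_inf_lb x y t0' uB; have := uv y.
  by case: (L y x _) => [l| |]//=; rewrite ?leey// !lee_fin; lra.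
Qed.

Lemma semigroup_mono t u v : BUC u -> BUC v ->
  (forall x, u x <= v x) -> forall x, S t u x <= S t v x.
Proof.
move=> uB vB uv x; rewrite -[leRHS]addr0; apply: semigroup_le_shift => // y.
by rewrite addr0.
Qed.

(** In the sup-inf of the two Lax-Oleinik formulas, let the inner player return
    to the starting point: the two actions cancel. *)
Lemma semigroupK_le t u : 0 <= t -> BUC u -> forall x, S t (S (- t) u) x <= u x.
Proof.
move=> t_ge0 uB x.
have [t0|t0] := ltP 0 t; last first.
  have -> : t = 0 by apply: le_anti; rewrite t_ge0 t0.
  by rewrite oppr0 !semigroup0.
apply: oleinik_sup_le => //; first exact: BUC_semigroup.
move=> y; have := oleinik_inf_lb y x t0 uB.
by case: (L x y t) => [l| |]//=; rewrite ?leNye// !lee_fin; lra.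
Qed.

Lemma semigroupK_ge t u : 0 <= t -> BUC u -> forall x, u x <= S (- t) (S t u) x.
Proof.
move=> t_ge0 uB x.
have [t0|t0] := ltP 0 t; last first.
  have -> : t = 0 by apply: le_anti; rewrite t_ge0 t0.
  by rewrite oppr0 !semigroup0.
apply: oleinik_inf_ge => //; first exact: BUC_semigroup.
move=> y; have := oleinik_sup_ub y x t0 uB.
by case: (L y x t) => [l| |]//=; rewrite ?leey// !lee_fin; lra.
Qed.

(** Cancel the shorter of the two opposite increments by adjointness; the
    semigroup law absorbs the rest. *)
Lemma semigroup_mixed s t u : 0 <= s -> 0 <= t -> BUC u ->
  forall x, S s (S (- t) u) x <= S (s - t) u x.
Proof.
move=> s0 t0 uB x; have [ts|st] := leP t s.
- have NtB := BUC_semigroup (- t) uB.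
  have st0 : 0 <= s - t by rewrite subr_ge0.
  rewrite -{1}(subrK t s) (semigroupD_ge0 st0 t0 NtB).
  apply: semigroup_mono => //; last exact: semigroupK_le.
  exact: BUC_semigroup.
- have Ns0 : - s <= 0 by rewrite oppr_le0.
  have st0 : s - t <= 0 by lra.
  have E : - t = - s + (s - t) by lra.
  rewrite [X in S s (S X u)]E (semigroupD_le0 Ns0 st0 uB).
  by apply: semigroupK_le => //; exact: BUC_semigroup.
Qed.

End Semigroup.

(** * Small increments after a flow *)

Section Flow.
Context {R : realType} {d : nat}.
Variable H : 'rV[R]_d -> 'rV[R]_d -> R.
Hypothesis H_well_posed : well_posed H /\ well_posed (oppH H).
Hypothesis H_lax_oleinik : lax_oleinik H.
Implicit Types (u v : 'rV[R]_d -> R) (x y : 'rV[R]_d) (t : R).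
Implicit Types (zeta eta : R -> R) (ts rs : seq R).

Notation S := (semigroup H).
Notation L := (minimal_action H).
Notation flow := (flow_along H).

Let SB t u : BUC u -> BUC (S t u).
Proof. exact: BUC_semigroup. Qed.

Lemma BUC_flow zeta s ts u : BUC u -> BUC (flow zeta s ts u).
Proof. by elim: ts s u => //= t ts IH s u uB; apply: IH; exact: SB. Qed.

Lemma flow_le_shift zeta s ts u v c : BUC u -> BUC v ->
  (forall x, u x <= v x + c) ->
  forall x, flow zeta s ts u x <= flow zeta s ts v x + c.
Proof.
elim: ts s u v => //= t ts IH s u v uB vB uv x.
by apply: IH; [exact: SB | exact: SB | exact: semigroup_le_shift].
Qed.

Lemma flow_mono zeta s ts u v : BUC u -> BUC v ->
  (forall x, u x <= v x) -> forall x, flow zeta s ts u x <= flow zeta s ts v x.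
Proof.
move=> uB vB uv x; rewrite -[leRHS]addr0; apply: flow_le_shift => // y.
by rewrite addr0.
Qed.

Section Translation.
Hypothesis H_indep : independent_of_x H.

Lemma action_translate t gamma x :
  action H t (fun s => gamma s + x) = action H t gamma.
Proof.
apply: eq_integral => s _.
have -> : derive1 (fun s => gamma s + x) s = derive1 gamma s.
  rewrite /derive1.
  suff -> : (fun h => h^-1 *: (gamma (h + s) + x - (gamma s + x))) =
    (fun h => h^-1 *: (gamma (h + s) - gamma s)) by [].
  by apply/funext => h; rewrite opprD addrACA subrr addr0.
rewrite /lagrangian; congr ereal_sup; apply/seteqP.
by split=> _ [p _ <-]; exists p => //; rewrite (H_indep p (gamma s)
  (gamma s + x)).
Qed.

Lemma minimal_action_translate_le x y z t : (L (x + z) (y + z) t <= L x y t)%E.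
Proof.
apply: le_ereal_inf_tmp => _ [gamma [glip g0 gt] <-].
rewrite -(action_translate t gamma z); apply: ereal_inf_lbound.
exists (fun s => gamma s + z) => //; split; rewrite ?g0 ?gt//.
move: glip => [M [Mr HM]]; exists M; split=> // K /HM HK p /HK /=.
by rewrite [- (_ + z)]opprD addrACA subrr addr0.
Qed.

Lemma minimal_action_translate x y z t : L (x + z) (y + z) t = L x y t.
Proof.
apply/le_anti/andP; split; first exact: minimal_action_translate_le.
by have := minimal_action_translate_le (x + z) (y + z) (- z) t; rewrite !addrK.
Qed.

Lemma BUC_translate u z : BUC u -> BUC (fun x => u (x + z)).
Proof.
move=> [[M [Mr HM]] cu]; split.
  by exists M; split=> // K /HM HK x _; exact: HK.
move=> e /cu[r r0 Hr]; exists r => // x y _ _ xy; apply: Hr => //.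
by rewrite opprD addrACA subrr addr0.
Qed.

Lemma semigroup_translate_le t u z x : BUC u ->
  S t (fun y => u (y + z)) x <= S t u (x + z).
Proof.
move=> uB; have uzB := BUC_translate z uB.
have [t0|t0|<-] := ltgtP 0 t; last by rewrite !semigroup0.
- apply: oleinik_sup_le => // y; rewrite -(minimal_action_translate x y z).
  exact: oleinik_sup_ub.
- rewrite -(opprK t); have t0' : 0 < - t by rewrite oppr_gt0.
  apply: oleinik_inf_ge => // y.
  have := oleinik_inf_lb H_well_posed H_lax_oleinik x (y - z) t0' uzB.
  by rewrite subrK -(minimal_action_translate (y - z) x z) subrK.
Qed.

Lemma semigroup_translate t u z : BUC u ->
  S t (fun y => u (y + z)) = (fun x => S t u (x + z)).
Proof.
move=> uB; apply/funext => x; apply/le_anti; rewrite semigroup_translate_le//=.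
have := semigroup_translate_le t (- z) (x + z) (BUC_translate z uB).
by rewrite addrK; congr (S t _ _ <= _); apply/funext => y; rewrite subrK.
Qed.

Lemma flow_translate zeta s ts u z : BUC u ->
  flow zeta s ts (fun y => u (y + z)) = (fun x => flow zeta s ts u (x + z)).
Proof.
elim: ts s u => //= t ts IH s u uB.
by rewrite semigroup_translate// IH//; exact: SB.
Qed.

(** A truncated cone pointing upwards with its tip at 0; truncation makes it
    bounded. *)
Definition cone_cap (K C : R) x : R := - Num.min (K * `|x|) C.

Lemma BUC_cone_cap K C : 0 < K -> 0 <= C -> BUC (cone_cap K C).
Proof.
move=> K0 C0; split.
  exists C; split; first exact: num_real.
  move=> M CM x _ /=; rewrite /cone_cap normrN ger0_norm.
    by rewrite ge_min (ltW CM) orbT.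
  by rewrite le_min C0 andbT mulr_ge0 // ltW.
move=> e e0; exists (e / K) => [|x y _ _ xy]; first by rewrite divr_gt0.
have : `|K * `|x| - K * `|y| | < e.
  rewrite -mulrBr normrM (gtr0_norm K0) mulrC -ltr_pdivlMr//.
  by apply: le_lt_trans xy; exact: ler_dist_dist.
rewrite /cone_cap; set a := K * _; set b := K * _; rewrite !ltr_norml.
by case: (leP a C); case: (leP b C); lra.
Qed.

(** The operators commute with translations, so a modulus of continuity of the
   datum is one of every function along the flow; such a function lies, near
   each of its graph points, above a translate of one fixed truncated cone. *)
Lemma flow_le_semigroup_indep u e : BUC u -> 0 < e -> exists2 r : R, 0 < r &
  forall a zeta s ts x, 0 <= a < r ->
    flow zeta s ts u x <= S a (flow zeta s ts u) x + e.
Proof.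
move=> uB e0; have [[M0 [_ HM]] cu] := uB.
have [M M_gt0 uM] : exists2 M, 0 < M & forall x, `|u x| <= M.
  exists (`|M0| + 1); first by rewrite ltr_wpDl.
  by move=> x; apply: (HM (`|M0| + 1)) => //; rewrite (le_lt_trans (ler_norm _))// ltrDl.
have e2 : 0 < e / 2 by lra.
have [r r0 Hr] := cu _ e2.
pose K := 2 * M / r; have K0 : 0 < K by rewrite divr_gt0// mulr_gt0.
pose C := 2 * M; have C0 : 0 <= C by rewrite mulr_ge0 // ltW.
have cB := BUC_cone_cap K0 C0.
(* The slope 2 M / r makes the cone reach the bound 2 M on the oscillation of
   u exactly at distance r, beyond which the modulus says nothing. *)
have uC x z : u x <= u (x + z) + (e / 2 - cone_cap K C z).
  rewrite /cone_cap opprK; have [zr|zr] := ltP `|z| r.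
    have : `|u x - u (x + z)| < e / 2.
      by apply: Hr => //; rewrite opprD addrA subrr add0r normrN.
    have : 0 <= Num.min (K * `|z|) C by rewrite le_min C0 mulr_ge0// ltW.
    rewrite ltr_norml; lra.
  have -> : Num.min (K * `|z|) C = C.
    apply/min_idPr; rewrite /K /C mulrAC ler_pdivlMr//.
    by rewrite ler_wpM2l// mulr_ge0// ltW.
  have := uM x; have := uM (x + z); rewrite !ler_norml /C; lra.
have [q q0 Hq] := semigroup_cont H_well_posed cB e2.
exists q => // a zeta s ts x /andP[a0 aq].
set w := flow zeta s ts u; have wB : BUC w by exact: BUC_flow.
(* Commuting the flow with the translation transfers the estimate on u to w. *)
have wC z : cone_cap K C z <= w (z + x) + (e / 2 - w x).
  have uzB := BUC_translate z uB.
  have := flow_le_shift zeta s ts uB uzB (fun x => uC x z) x.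
  rewrite flow_translate// -/w (addrC x z); lra.
have := semigroup_le_shift H_well_posed H_lax_oleinik a cB (BUC_translate x wB)
  wC 0.
rewrite semigroup_translate// add0r.
have := Hq a 0; rewrite (ger0_norm a0) => /(_ aq).
rewrite {2}/cone_cap normr0 mulr0 (min_idPl C0) oppr0 subr0 ler_norml; lra.
Qed.

End Translation.

(** The loops at x bound the near action from below at every radius, so the
    limit over the radius controls them all at once. *)
Lemma near_action_diag x r t : 0 <= r -> (L x x t <= near_action H r t)%E.
Proof.
move=> r0; apply: ereal_sup_ubound; exists (x, x) => //=.
by rewrite subrr normr0.
Qed.

Lemma cvg_near_action t : cvg (near_action H r t @[r --> (0 : R)^'+]).
Proof.
apply: nondecreasing_at_right_is_cvge; near=> r => p q _ _ pq.
apply: le_ereal_sup => _ [z /= zp <-]; exists z => //=; exact: le_trans pq.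
Unshelve. all: by end_near. Qed.

Lemma action_loop_small e : action_condition H -> 0 < e -> exists2 r : R, 0 < r &
  forall a x, 0 < a < r -> (L x x a <= e%:E)%E.
Proof.
move=> [_ Hlim] e0.
have : \forall a \near (0 : R)^'+,
    (lim (near_action H r a @[r --> (0 : R)^'+]) < e%:E)%E.
  apply: (Hlim [set y : \bar R | (y < e%:E)%E]).
  apply: open_nbhs_nbhs; split; first exact: open_ereal_lt_ereal.
  by rewrite /= lte_fin.
move=> [r /= r0 Hr]; exists r => // a x /andP[a0 ar].
have /Hr := a0; rewrite /= sub0r normrN gtr0_norm// => /(_ ar)/ltW; apply: le_trans.
apply: lime_ge; first exact: cvg_near_action.
by near=> q; apply: near_action_diag; near: q; exact: nbhs_right_ge.
Unshelve. all: by end_near. Qed.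

(** Staying put is an admissible strategy in the Lax-Oleinik formula. *)
Lemma le_semigroup_action e : action_condition H -> 0 < e -> exists2 r : R, 0 < r &
  forall a u x, BUC u -> 0 <= a < r -> u x <= S a u x + e.
Proof.
move=> Hact e0; have [r r0 Hr] := action_loop_small Hact e0.
exists r => // a v x vB /andP[]; rewrite le0r => /orP[/eqP -> _|a0 ar].
  by rewrite semigroup0// lerDl ltW.
have := oleinik_sup_ub H_lax_oleinik x x a0 vB.
have : (L x x a <= e%:E)%E by apply: Hr; rewrite a0.
by case: (L x x a) => [l| |]//=; rewrite !lee_fin; lra.
Qed.

Hypothesis H_action : independent_of_x H \/ action_condition H.

(** A small positive increment after a flow cannot lower the result by much,
    uniformly in the path. The opposite bound is [flow_sandwich] for
    zeta = eta. *)
Lemma flow_le_semigroup u e : BUC u -> 0 < e -> exists2 r : R, 0 < r &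
  forall a zeta s ts x, 0 <= a < r ->
    flow zeta s ts u x <= S a (flow zeta s ts u) x + e.
Proof.
move=> uB e0; case: H_action => [Hi|Ha]; first exact: flow_le_semigroup_indep.
have [r r0 Hr] := le_semigroup_action Ha e0.
by exists r => // a zeta s ts x ar; apply: Hr => //; exact: BUC_flow.
Qed.

End Flow.

(** * Comparison and stability of flows *)

(** As in [flow_along], the list of nodes does not contain the starting point, so
    that properties of the cells and flows decompose alike under concatenation. *)
Fixpoint cells {R : realType} (P : R -> R -> Prop) (s : R) (ts : seq R) : Prop :=
  if ts is t :: ts' then P s t /\ cells P t ts' else True.

Notation sorted_from := (cells (fun a b => a <= b)).

Section Cells.
Context {R : realType}.
Implicit Types (P Q : R -> R -> Prop) (s t : R) (ts : seq R).

Lemma cells_cat P s ts1 ts2 :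
  cells P s (ts1 ++ ts2) <-> cells P s ts1 /\ cells P (last s ts1) ts2.
Proof.
elim: ts1 s => [|t ts1 IH] s /=; first by split=> [|[]].
by rewrite IH; split=> [[? []]|[[]]].
Qed.

Lemma sub_cells P Q s ts : (forall a b, P a b -> Q a b) ->
  cells P s ts -> cells Q s ts.
Proof. by move=> PQ; elim: ts s => //= t ts IH s [/PQ ? /IH]. Qed.

Lemma cells_le_last P s ts : (forall a b, P a b -> a <= b) ->
  cells P s ts -> forall t, t \in s :: ts -> s <= t <= last s ts.
Proof.
move=> Ple; elim: ts s => [|t ts IH] s /=.
  by move=> _ t; rewrite inE => /eqP ->; rewrite lexx.
move=> [/Ple st /IH Hts] r; rewrite inE => /orP[/eqP ->|/Hts /andP[h1 h2]].
  rewrite lexx /=; have /andP[_] := Hts t (mem_head _ _); exact: le_trans.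
by rewrite h2 (le_trans st).
Qed.

Definition affine_cell (zeta : R -> R) (a b : R) := a <= b /\ affine_on zeta a b.

Lemma piecewise_affineP T ts zeta : piecewise_affine T ts zeta <->
  cells (affine_cell zeta) 0 ts /\ last 0 ts = T.
Proof.
suff gen s : [/\ path <=%R s ts, last s ts = T &
      forall i, (i < size ts)%N ->
        affine_on zeta (nth 0 (s :: ts) i) (nth 0 ts i)] <->
    cells (affine_cell zeta) s ts /\ last s ts = T by exact: gen.
elim: ts s => [|t ts IH] s /=.
  by split=> [[]|[_]].
split.
- move=> [/andP[st pts] lts Haff].
  have [] := (IH t).1; first by split=> // i; exact: (Haff i.+1).
  by split=> //; split=> //; split=> //; exact: (Haff 0%N).
- move=> [[[st ast] Hc] lts]; have [pts _ Haff] := (IH t).2 (conj Hc lts).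
  by split; rewrite ?st //= => -[|i] //; exact: Haff.
Qed.

End Cells.

Section Compare.
Context {R : realType} {d : nat}.
Variable H : 'rV[R]_d -> 'rV[R]_d -> R.
Hypothesis H_well_posed : well_posed H /\ well_posed (oppH H).
Hypothesis H_lax_oleinik : lax_oleinik H.
Implicit Types (u v : 'rV[R]_d -> R) (x y : 'rV[R]_d) (s t : R).
Implicit Types (zeta eta : R -> R) (ts rs : seq R).

Notation S := (semigroup H).
Notation flow := (flow_along H).

Let SB t u : BUC u -> BUC (S t u).
Proof. exact: BUC_semigroup. Qed.
Let FB zeta s ts u : BUC u -> BUC (flow zeta s ts u).
Proof. exact: BUC_flow. Qed.
Let S0 u : BUC u -> S 0 u = u.
Proof. exact: semigroup0. Qed.

Lemma flow_cat zeta s ts1 ts2 u :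
  flow zeta s (ts1 ++ ts2) u = flow zeta (last s ts1) ts2 (flow zeta s ts1 u).
Proof. by elim: ts1 s u => /=. Qed.

Lemma eq_flow zeta eta s ts u : {in s :: ts, zeta =1 eta} ->
  flow zeta s ts u = flow eta s ts u.
Proof.
elim: ts s u => //= t ts IH s u e.
rewrite !e ?inE ?eqxx ?orbT//; apply: IH => r rt; apply: e.
by rewrite inE rt orbT.
Qed.

(** Whatever the sign of alpha, two of the three increments can be merged, which
    leaves a positive increment after a negative one. *)
Lemma semigroup_sub_step a b alpha u : 0 <= a -> 0 <= b -> BUC u ->
  forall x, S b (S alpha (S (- a) u)) x <= S (b + alpha - a) u x.
Proof.
move=> a0 b0 uB x; have [al0|/ltW al0] := leP 0 alpha.
  rewrite -(semigroupD_ge0 H_well_posed b0 al0 (SB _ uB)).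
  by apply: semigroup_mixed => //; exact: addr_ge0.
have Na0 : - a <= 0 by rewrite oppr_le0.
rewrite -(semigroupD_le0 H_well_posed al0 Na0 uB).
have -> : alpha - a = - (a - alpha) by lra.
have -> : b + alpha - a = b - (a - alpha) by lra.
by apply: semigroup_mixed => //; lra.
Qed.

(** Following zeta after going down from eta + c to zeta, and then climbing back
    to eta + c, yields less than following eta. Between two nodes, the climb to
    eta and the next descent are inserted at the cost of an inequality,
    [semigroupK_ge], and the detour descent, step of zeta, climb is compared
    with the step of eta by [semigroup_sub_step]. *)
Lemma flow_sandwich zeta eta c s ts u : BUC u ->
    {in s :: ts, forall t, zeta t <= eta t + c} ->
  forall x,
    S (eta (last s ts) - zeta (last s ts) + c)
      (flow zeta s ts (S (- (eta s - zeta s + c)) u)) x <= flow eta s ts u x.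
Proof.
elim: ts s u => [|t ts IH] s u uB le_ze x /=.
  by apply: semigroupK_le => //; have := le_ze s (mem_head _ _); lra.
have le_t : {in t :: ts, forall r, zeta r <= eta r + c}.
  by move=> r rt; apply: le_ze; rewrite inE rt orbT.
have hs := le_ze s (mem_head _ _); have ht := le_t t (mem_head _ _).
set v := S (eta t - eta s) u; have vB : BUC v by exact: SB.
apply: le_trans (IH t v vB le_t x).
apply: semigroup_mono => //; [by do !(apply: FB || apply: SB)..|].
apply: flow_mono => //; [by do !apply: SB..|] => y.
set w := S (zeta t - zeta s) _; have wB : BUC w by do !apply: SB.
have bt : 0 <= eta t - zeta t + c by lra.
apply: le_trans (semigroupK_ge H_well_posed H_lax_oleinik bt wB y) _.
apply: semigroup_mono => //; [by do !apply: SB..|] => z.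
have as0 : 0 <= eta s - zeta s + c by lra.
apply: le_trans (semigroup_sub_step _ as0 bt uB z) _.
by rewrite /v; have -> : eta t - zeta t + c + (zeta t - zeta s) -
  (eta s - zeta s + c) = eta t - eta s by lra.
Qed.

Lemma flow_cst k s ts u : BUC u -> flow (cst k) s ts u = u.
Proof.
elim: ts s u => //= t ts IH s u uB.
by rewrite subrr S0//; exact: IH.
Qed.

(** Sandwich the path between the constants equal to its two end values: the
    upper constant gives one inequality, after inserting the adjoint pair, the
    lower one gives the other. *)
Lemma flow_from_min_to_max zeta s ts u : BUC u ->
    {in s :: ts, forall t, zeta s <= zeta t <= zeta (last s ts)} ->
  flow zeta s ts u = S (zeta (last s ts) - zeta s) u.
Proof.
move=> uB range; set m := zeta s; set M := zeta (last s ts).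
have mM : 0 <= M - m.
  by rewrite subr_ge0; have /andP[] := range s (mem_head _ _).
apply/funext => x; apply/le_anti/andP; split.
- set v := S (M - m) u; have vB : BUC v by exact: SB.
  apply: (@le_trans _ _ (flow zeta s ts (S (- (M - m)) v) x)).
    apply: flow_mono => //; first exact: SB.
    by move=> y; exact: semigroupK_ge.
  have /= := @flow_sandwich zeta (cst M) 0 s ts v vB.
  rewrite !addr0 subrr S0; last by apply: FB; exact: SB.
  by rewrite flow_cst//; apply => t /range /andP[].
- have /= := @flow_sandwich (cst m) zeta 0 s ts u uB.
  rewrite !addr0 -/m subrr oppr0 S0// flow_cst//; apply=> t /range /andP[].
  by rewrite addr0.
Qed.

Lemma flow_from_max_to_min zeta s ts u : BUC u ->
    {in s :: ts, forall t, zeta (last s ts) <= zeta t <= zeta s} ->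
  flow zeta s ts u = S (zeta (last s ts) - zeta s) u.
Proof.
move=> uB range; set M := zeta s; set m := zeta (last s ts).
have mM : 0 <= M - m.
  by rewrite subr_ge0; have /andP[] := range s (mem_head _ _).
have -> : m - M = - (M - m) by lra.
apply/funext => x; apply/le_anti/andP; split.
- set w := flow zeta s ts u; have wB : BUC w by exact: FB.
  apply: (le_trans (semigroupK_ge H_well_posed H_lax_oleinik mM wB x)).
  apply: semigroup_mono => //; first exact: SB.
  have /= := @flow_sandwich zeta (cst M) 0 s ts u uB.
  by rewrite !addr0 -/M subrr oppr0 S0// flow_cst//; apply=> t /range /andP[].
- have /= := @flow_sandwich (cst m) zeta 0 s ts u uB.
  rewrite !addr0 subrr S0; last by apply: FB; exact: SB.
  by rewrite flow_cst; [apply=> t /range /andP[]; rewrite addr0 | exact: SB].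
Qed.

Lemma semigroupD_affine zeta a b t u : affine_on zeta a b -> a <= t <= b ->
  BUC u -> S (zeta b - zeta t) (S (zeta t - zeta a) u) = S (zeta b - zeta a) u.
Proof.
move=> [c [m zE]] /andP[at_ tb] uB.
have ab := le_trans at_ tb.
rewrite !zE ?lexx ?at_ ?tb ?ab//.
set p := c + m * b - (c + m * t); set q := c + m * t - (c + m * a).
have -> : c + m * b - (c + m * a) = p + q by rewrite /p /q; lra.
have [m0|/ltW m0] := leP 0 m.
  have p0 : 0 <= p by rewrite /p; nra.
  have q0 : 0 <= q by rewrite /q; nra.
  by rewrite (semigroupD_ge0 H_well_posed p0 q0 uB).
have p0 : p <= 0 by rewrite /p; nra.
have q0 : q <= 0 by rewrite /q; nra.
by rewrite (semigroupD_le0 H_well_posed p0 q0 uB).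
Qed.

(** Two partitions are merged one node at a time; splitting an affine cell
    does not change a flow, since its two increments have the same sign. *)
Lemma common_refinement s ts1 ts2 :
    last s ts1 = last s ts2 ->
    sorted_from s ts1 -> sorted_from s ts2 ->
  exists2 rs, sorted_from s rs /\ last s rs = last s ts1 &
    forall zeta u, BUC u ->
      (cells (affine_cell zeta) s ts1 -> flow zeta s rs u = flow zeta s ts1 u) /\
      (cells (affine_cell zeta) s ts2 -> flow zeta s rs u = flow zeta s ts2 u).
Proof.
(* A sorted partition that ends where it starts carries no increment. *)
have stay rs r : last r rs = r -> sorted_from r rs ->
    forall zeta u, BUC u -> flow zeta r rs u = u.
  move=> lrs crs zeta u uB.
  have inr t : t \in r :: rs -> t = r.
    move=> /(cells_le_last (fun _ _ => id) crs); rewrite lrs => h.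
    by apply/le_anti; rewrite andbC.
  rewrite (@eq_flow zeta (cst (zeta r))) ?flow_cst// => t /inr -> //.
have affine_tail zeta (a b r : R) : a <= r -> r <= b ->
    affine_cell zeta a b -> affine_cell zeta r b.
  move=> ar rb [_ [c [m zE]]]; split=> //; exists c, m => t /andP[rt tb].
  by apply: zE; rewrite tb (le_trans ar).
have [n le_n] := ubnP (size ts1 + size ts2).
elim: n s ts1 ts2 le_n => // n IH s ts1 ts2 le_n.
case: ts1 le_n => [|t1 ts1].
  move=> _ lts _ c2; exists ts2 => [|zeta u uB]; first by rewrite lts.
  by split=> // _; rewrite stay.
case: ts2 => [|t2 ts2].
  move=> _ lts c1 _; exists (t1 :: ts1) => // zeta u uB.
  by split=> // _; rewrite stay.
rewrite /= addnS addSn !ltnS => le_n lts [st1 c1] [st2 c2].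
have [t12|/ltW t12] := leP t1 t2.
- have le_n1 : (size ts1 + size (t2 :: ts2) < n)%N by rewrite /= addnS.
  have [rs [crs lrs] Hrs] := IH t1 ts1 (t2 :: ts2) le_n1 lts c1 (conj t12 c2).
  exists (t1 :: rs) => [|zeta u uB] //=.
  have [H1 H2] := Hrs zeta _ (SB (zeta t1 - zeta s) uB).
  split=> -[a1 a2]; first exact: H1.
  rewrite H2/=; last by split=> //; exact: affine_tail a1.
  by rewrite (semigroupD_affine a1.2) ?st1 ?t12.
- have [rs [crs lrs] Hrs] := IH t2 (t1 :: ts1) ts2 le_n lts (conj t12 c1) c2.
  exists (t2 :: rs) => [//|zeta u uB /=].
  have [H1 H2] := Hrs zeta _ (SB (zeta t2 - zeta s) uB).
  split=> -[a1 a2]; last exact: H2.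
  rewrite H1/=; last by split=> //; exact: affine_tail a1.
  by rewrite (semigroupD_affine a1.2) ?st2 ?t12.
Qed.

Hypothesis H_action : independent_of_x H \/ action_condition H.

(** If the paths are delta-close, [flow_sandwich] with c = delta gives
    S_b (flow zeta (S_(-a) u)) <= flow eta u with 0 <= a, b <= 2 delta. The
    increment - a moves only the datum, which is fixed, and b is harmless by
    [flow_le_semigroup]. Exchange the paths for the other inequality. *)
Lemma flow_stable u e : BUC u -> 0 < e -> exists2 delta : R, 0 < delta &
  forall T zeta eta ts1 ts2,
    piecewise_affine T ts1 zeta -> piecewise_affine T ts2 eta ->
    (forall t, 0 <= t <= T -> `|zeta t - eta t| <= delta) ->
  forall x, `|flow zeta 0 ts1 u x - flow eta 0 ts2 u x| <= e.
Proof.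
move=> uB e0; have e2 : 0 < e / 2 by lra.
have [r r0 Hr] := semigroup_cont H_well_posed uB e2.
have [q q0 Hq] := flow_le_semigroup H_well_posed H_lax_oleinik H_action uB e2.
(* The gaps at the ends are at most 2 delta, which must stay below both radii. *)
pose delta := Num.min r q / 3.
have delta0 : 0 < delta by rewrite divr_gt0// lt_min r0.
have dr : 2 * delta < r.
  have : Num.min r q <= r by rewrite ge_min lexx.
  by rewrite /delta; lra.
have dq : 2 * delta < q.
  have : Num.min r q <= q by rewrite ge_min lexx orbT.
  by rewrite /delta; lra.
exists delta => // T.
have one_sided zeta eta rs : sorted_from 0 rs -> last 0 rs = T ->
    (forall t, 0 <= t <= T -> `|zeta t - eta t| <= delta) ->
    forall x, flow zeta 0 rs u x <= flow eta 0 rs u x + e.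
  move=> crs lrs close x.
  have inT t : t \in 0 :: rs -> `|zeta t - eta t| <= delta.
    by move=> /(cells_le_last (fun _ _ => id) crs); rewrite lrs; exact: close.
  have bound t : t \in 0 :: rs -> 0 <= eta t - zeta t + delta <= 2 * delta.
    by move=> /inT; rewrite ler_norml; lra.
  have /andP[a0 a2] := bound 0 (mem_head _ _).
  have /andP[b0 b2] := bound _ (mem_last 0 rs).
  have le_ze : {in 0 :: rs, forall t, zeta t <= eta t + delta}.
    by move=> t /bound /andP[? ?]; lra.
  have := flow_sandwich uB le_ze x.
  set a := eta 0 - _ + _ in a0 a2 *; set b := eta (last _ _) - _ + _ in b0 b2 *.
  set w := flow zeta 0 rs u => Hs.
  have aB : BUC (S (- a) u) by exact: SB.
  have wB : BUC w by exact: FB.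
  have ua y : u y <= S (- a) u y + e / 2.
    have := Hr (- a) y; rewrite normrN ger0_norm// => /(_ (le_lt_trans a2 dr)).
    by rewrite ler_norml; lra.
  have wa := flow_le_shift H_well_posed H_lax_oleinik zeta 0 rs uB aB ua.
  have wb : w x <= S b w x + e / 2 by apply: Hq; rewrite b0 (le_lt_trans b2).
  have := semigroup_le_shift H_well_posed H_lax_oleinik b wB (FB _ _ _ aB) wa x.
  lra.
move=> zeta eta ts1 ts2 /piecewise_affineP[c1 l1] /piecewise_affineP[c2 l2] close x.
have [|||rs [crs lrs] Hrs] := @common_refinement 0 ts1 ts2.
- by rewrite l1 l2.
- by apply: sub_cells c1 => ? ? [].
- by apply: sub_cells c2 => ? ? [].
rewrite -((Hrs zeta u uB).1 c1) -((Hrs eta u uB).2 c2).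
rewrite l1 in lrs.
have h1 := one_sided zeta eta rs crs lrs close x.
have h2 : flow eta 0 rs u x <= flow zeta 0 rs u x + e.
  by apply: one_sided => // t /close; rewrite distrC.
rewrite ler_norml; apply/andP; split; lra.
Qed.

End Compare.

(** * Piecewise linear interpolation *)

Section Interpolation.
Context {R : realType}.
Implicit Types (f g zeta : R -> R) (s t a b : R) (ts : seq R).

Definition between (a b y : R) := (a <= y <= b) || (b <= y <= a).

Lemma chord_left f a b : chord f a b a = f a.
Proof. by rewrite /chord subrr !mul0r addr0. Qed.

Lemma chord_right f a b : chord f a b b = f b.
Proof.
rewrite /chord; have [->|ab] := eqVneq a b; first by rewrite !subrr !mul0r addr0.
by rewrite divff ?mul1r ?subr_eq0 1?eq_sym// addrC subrK.
Qed.

Lemma chord_between f a b t : a <= t <= b -> between (f a) (f b) (chord f a b t).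
Proof.
move=> /andP[at_ tb]; rewrite /between /chord.
have [ab|ba] := ltP a b; last first.
  have -> : t = a by apply/le_anti; rewrite at_ (le_trans tb).
  by rewrite subrr !mul0r addr0 !lexx /= andbT le_total.
have ba0 : 0 < b - a by rewrite subr_gt0.
have l0 : 0 <= (t - a) / (b - a) by rewrite divr_ge0 ?subr_ge0// ltW.
have l1 : (t - a) / (b - a) <= 1 by rewrite ler_pdivrMr// mul1r lerB.
have [h|/ltW h] := leP (f a) (f b); apply/orP; [left|right];
  by apply/andP; split; nra.
Qed.

Lemma between_trans (a b y1 y2 z : R) :
  between a b y1 -> between a b y2 -> between y1 y2 z -> between a b z.
Proof.
move=> /orP[]/andP[? ?] /orP[]/andP[? ?] /orP[]/andP[? ?];
  by apply/orP; ((left; apply/andP; split; lra) || (right; apply/andP; split; lra)).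
Qed.

Lemma between_dist (a b y z : R) :
  between a b y -> between a b z -> `|y - z| <= `|a - b|.
Proof.
move=> /orP[]/andP[? ?] /orP[]/andP[? ?]; have := ler_norm (a - b);
  have := ler_norm (b - a); rewrite (distrC b a) => ? ?;
  by rewrite ler_norml; apply/andP; split; lra.
Qed.

Lemma affine_chord f a b : affine_on (chord f a b) a b.
Proof.
exists (f a - a / (b - a) * (f b - f a)), ((f b - f a) / (b - a)) => t _.
by rewrite /chord; ring.
Qed.

Fixpoint interpolate f s ts t : R :=
  if ts is t1 :: ts' then
    if t <= t1 then chord f s t1 t else interpolate f t1 ts' t
  else f s.

Lemma interpolate_left f s ts : sorted_from s ts -> interpolate f s ts s = f s.
Proof. by case: ts => //= t ts [-> _]; rewrite chord_left. Qed.

Lemma interpolate_tail f s t1 ts t : sorted_from t1 ts -> t1 <= t ->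
  interpolate f s (t1 :: ts) t = interpolate f t1 ts t.
Proof.
move=> cts t1t /=; case: (leP t t1) => // tt1.
have -> : t = t1 by apply/le_anti; rewrite tt1.
by rewrite chord_right interpolate_left.
Qed.

Lemma interpolate_node f s ts : sorted_from s ts ->
  {in s :: ts, interpolate f s ts =1 f}.
Proof.
elim: ts s => [|t1 ts IH] s cts t; first by rewrite inE => /eqP ->.
have [st1 cts1] := cts.
rewrite inE => /orP[/eqP ->|tin]; first exact: interpolate_left.
have /andP[t1t _] := cells_le_last (fun _ _ => id) cts1 tin.
by rewrite interpolate_tail// IH.
Qed.

Lemma eq_cells_affine f g s ts : (forall t, s <= t -> f t = g t) ->
  cells (affine_cell f) s ts -> cells (affine_cell g) s ts.
Proof.
elim: ts s => //= t1 ts IH s fg [[st1 [c [m fE]]] cts]; split.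
  split=> //; exists c, m => t tin; rewrite -fg ?fE//.
  by case/andP: tin.
by apply: IH cts => t t1t; apply: fg; exact: le_trans t1t.
Qed.

Lemma interpolate_affine f s ts : sorted_from s ts ->
  cells (affine_cell (interpolate f s ts)) s ts.
Proof.
elim: ts s => // t1 ts IH s [st1 cts]; split.
  split=> //; have [c [m fE]] := affine_chord f s t1.
  by exists c, m => t tin; rewrite /= (andP tin).2 fE.
apply: eq_cells_affine (IH _ cts) => t t1t.
by rewrite interpolate_tail.
Qed.

Definition chord_close f g (delta : R) a b :=
  a <= b /\ forall t, a <= t <= b -> `|chord f a b t - g t| <= delta.

Lemma interpolate_close f g (delta : R) s ts : (0 < size ts)%N ->
    cells (chord_close f g delta) s ts ->
  forall t, s <= t <= last s ts -> `|interpolate f s ts t - g t| <= delta.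
Proof.
elim: ts s => // t1 ts IH s _ [[st1 close] cts] t /= /andP[st tl].
case: (leP t t1) => [tt1|t1t]; first by apply: close; rewrite st.
case: ts IH cts tl => [|t2 ts] IH cts tl; first by move: tl; rewrite /= leNgt t1t.
by apply: IH => //; rewrite tl ltW.
Qed.

Lemma affine_cells_lipschitz zeta s ts : cells (affine_cell zeta) s ts ->
  exists2 K, 0 <= K & forall t t', s <= t -> t <= t' -> t' <= last s ts ->
    `|zeta t - zeta t'| <= K * (t' - t).
Proof.
elim: ts s => [|t1 ts IH] s /=.
  move=> _; exists 0 => // t t' st tt' t's.
  have -> : t = t' by apply/le_anti; rewrite tt' (le_trans t's).
  by rewrite subrr normr0 mul0r.
move=> [[st1 [c [m zE]]] /IH[K K0 HK]].
have Km : 0 <= Num.max K `|m| by rewrite le_max K0.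
have HK' t t' : t1 <= t -> t <= t' -> t' <= last t1 ts ->
    `|zeta t - zeta t'| <= Num.max K `|m| * (t' - t).
  move=> t1t tt' t'l; apply: le_trans (HK _ _ t1t tt' t'l) _.
  by rewrite ler_wpM2r ?subr_ge0// le_max lexx.
have Hm t t' : s <= t -> t <= t' -> t' <= t1 ->
    `|zeta t - zeta t'| <= Num.max K `|m| * (t' - t).
  move=> st tt' t't1.
  rewrite !zE ?st ?(le_trans st tt') ?t't1 ?(le_trans tt')//.
  have -> : c + m * t - (c + m * t') = - (m * (t' - t)) by lra.
  rewrite normrN normrM (ger0_norm (_ : 0 <= t' - t)) ?subr_ge0//.
  by rewrite ler_wpM2r ?subr_ge0// le_max lexx orbT.
exists (Num.max K `|m|) => // t t' st tt' t'l.
have [t1t|/ltW tt1] := leP t1 t; first exact: HK'.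
have [t't1|/ltW t1t'] := leP t' t1; first exact: Hm.
have := ler_normD (zeta t - zeta t1) (zeta t1 - zeta t').
rewrite addrA subrK.
have := Hm t t1 st tt1 (lexx _); have := HK' t1 t' (lexx _) t1t' t'l.
set M := Num.max _ _; nra.
Qed.

Lemma fine_partition (r a b : R) : 0 < r -> a <= b -> exists2 ts,
  last a ts = b & cells (fun x y => x <= y <= x + r) a ts.
Proof.
move=> r0 ab.
have [n] : exists n : nat, b - a <= n%:R * r.
  have ba0 : 0 <= (b - a) / r by rewrite divr_ge0 ?subr_ge0// ltW.
  have h := archi_boundP ba0.
  by exists (Num.bound ((b - a) / r)); rewrite -ler_pdivrMr// ltW.
elim: n a ab => [|n IH] a ab.
  rewrite mul0r subr_le0 => ba; exists [::] => //=.
  by apply/le_anti; rewrite ab.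
move=> bn; have ma : a <= Num.min (a + r) b by rewrite le_min ab lerDl ltW.
have mb : Num.min (a + r) b <= b by rewrite ge_min lexx orbT.
have [|ts lts cts] := IH _ mb.
  have : b - (a + r) <= n%:R * r by move: bn; rewrite -addn1 natrD mulrDl mul1r; lra.
  have : 0 <= n%:R * r by rewrite mulr_ge0// ltW.
  by case: (leP (a + r) b) => _; lra.
exists (Num.min (a + r) b :: ts) => //=; split=> //.
by rewrite ma ge_min lexx.
Qed.

End Interpolation.

Section Continuity.
Context {R : realType}.
Implicit Types (xi : R -> R) (a b t : R).

Lemma uniformly_continuous_segment xi a b (e : R) :
    {within `[a, b], continuous xi} -> 0 < e ->
  exists2 r : R, 0 < r & forall s t, a <= s <= b -> a <= t <= b ->
    `|s - t| < r -> `|xi s - xi t| < e.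
Proof.
move=> /subspace_continuousP xi_c e0.
have /compact_near_coveringP := @segment_compact R a b.
move=> /(_ _ (0 : R)^'+ (fun r s => a <= s <= b -> forall t, a <= t <= b ->
  `|s - t| < r -> `|xi s - xi t| < e)) [].
  move=> x /= xab; have /cvgrPdist_lt /(_ (e / 2)) := xi_c x xab.
  rewrite divr_gt0// => /(_ isT)[r /= r0 Hr].
  have r2 : 0 < r / 2 by rewrite divr_gt0.
  have close s : a <= s <= b -> `|x - s| < r -> `|xi x - xi s| < e / 2.
    by move=> sab xs; apply: Hr => //=; rewrite in_itv.
  exists (ball x (r / 2), [set q | 0 < q < r / 2]).
    split; first exact: nbhsx_ballx.
    exists (r / 2) => // q /=; rewrite sub0r normrN => qr q0.
    by rewrite q0 -(gtr0_norm q0).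
  move=> [s q] [/= xs /andP[q0 qr]] sab t tab st.
  rewrite -ball_normE /= in xs.
  have xt : `|x - t| < r.
    rewrite -(subrK s x) -addrA; apply: le_lt_trans (ler_normD _ _) _; lra.
  have h1 := close s sab (lt_trans xs (_ : r / 2 < r)); have h2 := close t tab xt.
  rewrite -(subrK (xi x) (xi s)) -addrA; apply: le_lt_trans (ler_normD _ _) _.
  by rewrite distrC; have := h1 ltac:(lra); lra.
move=> r /= r0 Hr; exists (r / 2); first by rewrite divr_gt0.
move=> s t sab tab st; apply: (Hr (r / 2)) => //=.
- by rewrite sub0r normrN gtr0_norm; lra.
- by rewrite divr_gt0.
Qed.

End Continuity.

(** * The times of the reduced path *)

Section Extrema.
Context {R : realType}.
Implicit Types (a b t : R) (A : set R).

Definition extremal (xi : R -> R) (c : bool) a b : set R :=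
  if c then argmax xi a b else argmin xi a b.

Lemma extremal_sub xi c a b a' b' t : a <= a' -> b' <= b -> a' <= t <= b' ->
  extremal xi c a b t -> extremal xi c a' b' t.
Proof.
move=> aa' bb' tab; case: c => -[_ Ht]; split=> // s /andP[? ?]; apply: Ht;
  by rewrite (le_trans aa')// (le_trans _ bb').
Qed.

Lemma sup_adherent_norm A a b (r : R) : A !=set0 -> (A `<=` `[a, b]) -> 0 < r ->
  exists2 x, A x & `|x - sup A| < r.
Proof.
move=> A0 Aab r0; have ubA : has_ubound A.
  by exists b => x /Aab /=; rewrite in_itv/= => /andP[].
have [x Ax xs] := sup_adherent r0 (conj A0 ubA); exists x => //.
have := ub_le_sup ubA Ax; rewrite ltr_norml => h; apply/andP; split; lra.
Qed.

Lemma inf_adherent_norm A a b (r : R) : A !=set0 -> (A `<=` `[a, b]) -> 0 < r ->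
  exists2 x, A x & `|x - inf A| < r.
Proof.
move=> A0 Aab r0; have lbA : has_lbound A.
  by exists a => x /Aab /=; rewrite in_itv/= => /andP[].
have [x Ax xs] := inf_adherent r0 (conj A0 lbA); exists x => //.
have := ge_inf lbA Ax; rewrite ltr_norml => h; apply/andP; split; lra.
Qed.

Variables (T : R) (xi : R -> R).
Hypothesis T_ge0 : 0 <= T.
Hypothesis xi_continuous : {within `[0, T], continuous xi}.

Notation ext := (extremal xi).

Lemma adherent_segment A a b m : (A `<=` `[a, b]) ->
  (forall r : R, 0 < r -> exists2 x, A x & `|x - m| < r) -> a <= m <= b.
Proof.
move=> Aab adh; apply/andP; split; rewrite leNgt; apply/negP => lt_m.
- have [|x /Aab] := adh (a - m); first by lra.
  by rewrite /= in_itv/= ltr_norml => /andP[? ?] /andP[? ?]; lra.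
- have [|x /Aab] := adh (m - b); first by lra.
  by rewrite /= in_itv/= ltr_norml => /andP[? ?] /andP[? ?]; lra.
Qed.

Lemma extremal_segment c a b : ext c a b `<=` `[a, b].
Proof. by case: c => t [] ? _ /=; rewrite in_itv. Qed.

Lemma extremal_closed c a b m : 0 <= a -> b <= T ->
  (forall r : R, 0 < r -> exists2 x, ext c a b x & `|x - m| < r) -> ext c a b m.
Proof.
move=> a0 bT adh.
have mab := adherent_segment (@extremal_segment c a b) adh.
have sub x : a <= x <= b -> 0 <= x <= T.
  by move=> /andP[? ?]; rewrite (le_trans a0)// (le_trans _ bT).
have unif e : 0 < e -> exists2 x, ext c a b x & `|xi x - xi m| < e.
  move=> e0; have [r r0 Hr] := uniformly_continuous_segment xi_continuous e0.
  have [x xE xm] := adh r r0; exists x => //; apply: Hr => //; last exact: sub.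
  by apply: sub; have := extremal_segment xE; rewrite /= in_itv.
case: c adh unif => adh unif; split=> // s sab; rewrite leNgt; apply/negP => lt_s.
- have [|x [_ Hx]] := unif (xi s - xi m); first by lra.
  by have := Hx s sab; rewrite ltr_norml => ? /andP[? ?]; lra.
- have [|x [_ Hx]] := unif (xi m - xi s); first by lra.
  by have := Hx s sab; rewrite ltr_norml => ? /andP[? ?]; lra.
Qed.

Lemma extremal_nonempty c a b : 0 <= a -> a <= b -> b <= T -> ext c a b !=set0.
Proof.
move=> a0 ab bT.
have xi_ab : {within `[a, b], continuous xi}.
  apply: continuous_subspaceW xi_continuous => x /=; rewrite !in_itv/=.
  by move=> /andP[? ?]; rewrite (le_trans a0)// (le_trans _ bT).
case: c.
- have [t tab Ht] := EVT_max ab xi_ab; exists t; split; first by move: tab; rewrite in_itv.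
  by move=> s sab; apply: Ht; rewrite in_itv.
- have [t tab Ht] := EVT_min ab xi_ab; exists t; split; first by move: tab; rewrite in_itv.
  by move=> s sab; apply: Ht; rewrite in_itv.
Qed.

Lemma sup_extremal c a b : 0 <= a -> a <= b -> b <= T -> ext c a b (sup (ext c a b)).
Proof.
move=> a0 ab bT; apply: extremal_closed => // r r0.
by apply: sup_adherent_norm r0; [exact: extremal_nonempty | exact: extremal_segment].
Qed.

Lemma inf_extremal c a b : 0 <= a -> a <= b -> b <= T -> ext c a b (inf (ext c a b)).
Proof.
move=> a0 ab bT; apply: extremal_closed => // r r0.
by apply: inf_adherent_norm r0; [exact: extremal_nonempty | exact: extremal_segment].
Qed.

Lemma extremal_between c a b s s' t : ext c a b s -> ext (~~ c) a b s' ->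
  a <= t <= b -> between (xi s) (xi s') (xi t).
Proof.
rewrite /between.
by case: c => -[_ hs] [_ hs'] tab; rewrite hs// hs'// ?orbT.
Qed.

(** The supremum of the extremal times is a limit of maximum times or a limit
    of minimum times, and both sets are closed. *)
Lemma tau_start_extremal : ext (tau_start T xi).1 0 T (tau_start T xi).2.
Proof.
rewrite /tau_start /=; set A := _ `|` _; case: asboolP => //= nmax.
have A_sub : A `<=` `[0, T].
  by move=> t [/(@extremal_segment true)|/(@extremal_segment false)].
have A0 : A !=set0.
  have [t tmax] := @extremal_nonempty true 0 T (lexx _) T_ge0 (lexx _).
  by exists t; left.
have [r0 r0_gt0 far] : exists2 r : R, 0 < r &
    forall x, argmax xi 0 T x -> r <= `|x - sup A|.
  apply: contrapT => near_max; apply: nmax.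
  apply: (@extremal_closed true) => // r r_gt0; apply: contrapT => far.
  apply: near_max; exists r => // x xmax; rewrite leNgt; apply/negP => xr.
  by apply: far; exists x.
apply: (@extremal_closed false) => // r r_gt0.
have [|x [xmax|xmin] xr] := @sup_adherent_norm A 0 T (Num.min r r0) A0 A_sub.
- by rewrite lt_min r_gt0.
- by have := far x xmax; rewrite leNgt (lt_le_trans xr)// ge_min lexx orbT.
- by exists x => //; rewrite (lt_le_trans xr)// ge_min lexx.
Qed.

Lemma tau_next_extremal k : 0 <= k.2 <= T -> ext (~~ k.1) k.2 T (tau_next T xi k).2.
Proof.
move=> /andP[k0 kT]; rewrite /tau_next/=.
have := sup_extremal (~~ k.1) k0 kT (lexx T).
by rewrite /extremal; case: (k.1).
Qed.

Lemma tau_prev_extremal k : 0 <= k.2 <= T -> ext (~~ k.1) 0 k.2 (tau_prev xi k).2.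
Proof.
move=> /andP[k0 kT]; rewrite /tau_prev/=.
have := inf_extremal (~~ k.1) (lexx 0) k0 kT.
by rewrite /extremal; case: (k.1).
Qed.

Let fwd n := iter n (tau_next T xi) (tau_start T xi).
Let bwd n := iter n (tau_prev xi) (tau_start T xi).

Lemma fwd_extremal n : 0 <= (fwd n).2 <= T /\ ext (fwd n).1 (fwd n).2 T (fwd n).2.
Proof.
elim: n => [|n [nT _]] /=.
  have E := tau_start_extremal.
  have /= := extremal_segment E; rewrite in_itv/= => tT; split=> //.
  by case/andP: (tT) => t0 tT'; apply: extremal_sub E; rewrite ?lexx.
have E := tau_next_extremal nT.
have /= := extremal_segment E; rewrite in_itv/= => /andP[nn nnT].
case/andP: (nT) => n0 _; split; first by rewrite nnT (le_trans n0).
by apply: extremal_sub E; rewrite ?lexx ?nnT.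
Qed.

Lemma bwd_extremal n : 0 <= (bwd n).2 <= T /\ ext (bwd n).1 0 (bwd n).2 (bwd n).2.
Proof.
elim: n => [|n [nT _]] /=.
  have E := tau_start_extremal.
  have /= := extremal_segment E; rewrite in_itv/= => tT; split=> //.
  by case/andP: (tT) => t0 tT'; apply: extremal_sub E; rewrite ?lexx ?t0.
have E := tau_prev_extremal nT.
have /= := extremal_segment E; rewrite in_itv/= => /andP[nn nnT].
case/andP: (nT) => _ nT'; split; first by rewrite nn (le_trans nnT).
by apply: extremal_sub E; rewrite ?lexx ?nn.
Qed.

Notation tau := (tau T xi).

Lemma opp_natS (n : nat) : - n.+1%:Z + 1 = - n%:Z :> int.
Proof. by rewrite intS opprD addrAC addNr add0r. Qed.

Lemma tau_nat (n : nat) : tau n%:Z = (fwd n).2. Proof. by []. Qed.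

Lemma tau_opp (n : nat) : tau (- n%:Z) = (bwd n).2.
Proof. by case: n => [|n] //; rewrite -NegzE. Qed.

Lemma tau_natS (n : nat) : tau (n%:Z + 1) = (fwd n.+1).2.
Proof. by rewrite -tau_nat intS (addrC 1). Qed.

Lemma tau_oppS (n : nat) : tau (- n.+1%:Z + 1) = (bwd n).2.
Proof. by rewrite opp_natS tau_opp. Qed.

Lemma tau_segment i : 0 <= tau i <= T.
Proof.
case: i => n; first by rewrite tau_nat; have [] := fwd_extremal n.
by rewrite NegzE tau_opp; have [] := bwd_extremal n.+1.
Qed.

(** The time tau_n is extremal on the tail, and tau_(n+1) is the opposite
    extremum there. Hence |xi (tau_n) - xi (tau_(n+1))| is the oscillation on
    the whole tail. *)
Lemma tail_between (n : nat) t : tau n%:Z <= t <= T ->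
  between (xi (tau n%:Z)) (xi (tau (n%:Z + 1))) (xi t).
Proof.
rewrite tau_nat tau_natS => tin; have [nT E] := fwd_extremal n.
exact: extremal_between E (tau_next_extremal nT) tin.
Qed.

Lemma head_between (n : nat) t : 0 <= t <= tau (- n%:Z) ->
  between (xi (tau (- n.+1%:Z))) (xi (tau (- n%:Z))) (xi t).
Proof.
rewrite !tau_opp => tin; have [nT E] := bwd_extremal n.
by have := extremal_between E (tau_prev_extremal nT) tin; rewrite /between orbC.
Qed.

Lemma tau_leS i : tau i <= tau (i + 1).
Proof.
case: i => n.
  rewrite tau_nat tau_natS; have [nT _] := fwd_extremal n.
  by have /= := extremal_segment (tau_next_extremal nT); rewrite in_itv => /andP[].
rewrite NegzE tau_oppS tau_opp; have [nT _] := bwd_extremal n.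
by have /= := extremal_segment (tau_prev_extremal nT); rewrite in_itv => /andP[].
Qed.

Lemma tau_le i j : i <= j -> tau i <= tau j.
Proof.
move=> ij; have [n ->] : exists n : nat, j = i + n%:Z.
  by exists (absz (j - i)); rewrite gez0_abs ?subr_ge0//; ring.
elim: n => [|n IH]; first by rewrite addr0.
by rewrite -addn1 PoszD addrA; apply: le_trans IH (tau_leS _).
Qed.

Lemma tau_between i t : tau i <= t <= tau (i + 1) ->
  between (xi (tau i)) (xi (tau (i + 1))) (xi t).
Proof.
case: i => n.
  move=> /andP[it ti]; apply: tail_between; rewrite it (le_trans ti)//.
  by case/andP: (tau_segment (n%:Z + 1)).
rewrite NegzE opp_natS.
move=> /andP[it ti]; apply: head_between; rewrite ti andbT (le_trans _ it)//.
by case/andP: (tau_segment (- n.+1%:Z)).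
Qed.

Lemma bounded_small_step (f : nat -> R) (M r : R) : (forall n, f n <= M) -> 0 < r ->
  exists n, f n.+1 - f n < r.
Proof.
move=> fM r0; apply: contrapT => /forallNP big.
(* If all steps were at least r, the sequence would be unbounded. *)
have lower n : f 0%N + n%:R * r <= f n.
  elim: n => [|n IH]; first by rewrite mul0r addr0.
  have : r <= f n.+1 - f n by rewrite leNgt; apply/negP/big.
  by rewrite -addn1 natrD mulrDl mul1r addn1; lra.
have := fM 0%N; rewrite -subr_ge0 => M0.
have /archi_boundP : 0 <= (M - f 0%N) / r by rewrite divr_ge0// ltW.
rewrite ltr_pdivrMr//; set n := Num.bound _.
have := lower n; have := fM n; lra.
Qed.

(** The monotone bounded sequence tau_n makes an arbitrarily small step, and xi
    is uniformly continuous. *)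
Lemma small_tail e : 0 < e ->
  exists n : nat, `|xi (tau n%:Z) - xi (tau (n%:Z + 1))| <= e.
Proof.
move=> e0; have [r r0 Hr] := uniformly_continuous_segment xi_continuous e0.
have [|n] := @bounded_small_step (fun n => tau n%:Z) T r _ r0.
  by move=> n; case/andP: (tau_segment n%:Z).
rewrite intS (addrC 1) => step; exists n; apply/ltW/Hr; [exact: tau_segment..|].
by rewrite distrC ger0_norm ?subr_ge0 ?tau_leS.
Qed.

Lemma small_head e : 0 < e ->
  exists n : nat, `|xi (tau (- n.+1%:Z)) - xi (tau (- n%:Z))| <= e.
Proof.
move=> e0; have [r r0 Hr] := uniformly_continuous_segment xi_continuous e0.
have [|n] := @bounded_small_step (fun n => - tau (- n%:Z)) 0 r _ r0.
  by move=> n; rewrite oppr_le0; case/andP: (tau_segment (- n%:Z)).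
move=> step; exists n; apply/ltW/Hr; [exact: tau_segment..|].
have le_tau : tau (- n.+1%:Z) <= tau (- n%:Z) by apply: tau_le; rewrite lerN2 lez_nat.
rewrite distrC ger0_norm ?subr_ge0//.
move: step => /=; lra.
Qed.

Lemma reduced_pathP t : reduced_path T xi t = xi t \/
  exists i, tau i <= t < tau (i + 1) /\
    reduced_path T xi t = chord xi (tau i) (tau (i + 1)) t.
Proof.
rewrite /reduced_path; case: xgetP => [y -> [i [it ->]]|_]; last by left.
by right; exists i.
Qed.

(** By monotonicity of tau all the indices i with tau_i <= t < tau_(i+1)
    coincide; at the right end both sides are the value of xi. *)
Lemma reduced_path_chord i t : tau i <= t <= tau (i + 1) ->
  reduced_path T xi t = chord xi (tau i) (tau (i + 1)) t.
Proof.
have inside j s : tau j <= s < tau (j + 1) ->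
    reduced_path T xi s = chord xi (tau j) (tau (j + 1)) s.
  move=> js; rewrite /reduced_path; case: xgetP => [y -> [k [ks ->]]|none].
    suff -> : k = j by [].
    have lt_k k' j' : tau k' <= s -> s < tau (j' + 1) -> k' <= j'.
      move=> ks' sj'; rewrite -ltzD1 ltNge; apply/negP => /tau_le.
      by rewrite leNgt (le_lt_trans ks').
    by case/andP: js ks => js1 js2 /andP[ks1 ks2]; apply/le_anti; rewrite !lt_k.
  by have [] := none (chord xi (tau j) (tau (j + 1)) s); exists j.
move=> /andP[it]; rewrite le_eqVlt => /orP[/eqP ->|ti]; last first.
  by apply: inside; rewrite it.
rewrite chord_right; have [->//|[j [jt ->]]] := reduced_pathP (tau (i + 1)).
case/andP: jt => jt tj.
suff <- : tau j = tau (i + 1) by rewrite chord_left.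
apply/le_anti; rewrite jt /= tau_le// -ltzD1 ltNge; apply/negP => /tau_le.
by rewrite leNgt tj.
Qed.

Lemma reduced_path_tail (n : nat) t : tau n%:Z <= t <= T ->
  between (xi (tau n%:Z)) (xi (tau (n%:Z + 1))) (reduced_path T xi t).
Proof.
move=> /andP[nt tT].
have [->|[i [/andP[it ti] ->]]] := reduced_pathP t; first by apply: tail_between; rewrite nt.
have ni : n%:Z <= i.
  by rewrite -ltzD1 ltNge; apply/negP => /tau_le; rewrite leNgt (le_lt_trans nt).
apply: between_trans (chord_between xi (_ : tau i <= t <= tau (i + 1))).
- by apply: tail_between; rewrite tau_le//; case/andP: (tau_segment i).
- apply: tail_between; rewrite tau_le ?(le_trans ni)// ?lerDl//.
  by case/andP: (tau_segment (i + 1)).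
- by rewrite it ltW.
Qed.

Lemma reduced_path_head (n : nat) t : 0 <= t <= tau (- n%:Z) ->
  between (xi (tau (- n.+1%:Z))) (xi (tau (- n%:Z))) (reduced_path T xi t).
Proof.
move=> /andP[t0 tn]; move: tn; rewrite le_eqVlt => /orP[/eqP ->|tn].
  have := @reduced_path_chord (- n.+1%:Z) (tau (- n%:Z)).
  rewrite opp_natS lexx tau_le ?lerN2 ?lez_nat// => /(_ isT) ->.
  by rewrite chord_right /between lexx andbT /= le_total.
have [->|[i [/andP[it ti] ->]]] := reduced_pathP t.
  by apply: head_between; rewrite t0 ltW.
have ni : i + 1 <= - n%:Z.
  by rewrite lezD1 ltNge; apply/negP => /tau_le; rewrite leNgt (le_lt_trans it).
apply: between_trans (chord_between xi (_ : tau i <= t <= tau (i + 1))).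
- apply: head_between; rewrite tau_le ?(le_trans _ ni) ?lerDl// andbT.
  by case/andP: (tau_segment i).
- apply: head_between; rewrite tau_le// andbT.
  by case/andP: (tau_segment (i + 1)).
- by rewrite it ltW.
Qed.

End Extrema.

(** * Limits of flows along coupled approximations *)

Lemma uniform_cvgP {R : realType} {U : choiceType} (A : set U)
    (f : nat -> U -> R) (g : U -> R) :
  {uniform A, f @ \oo --> g} <->
  forall e, 0 < e -> \forall n \near \oo, forall y, A y -> `|g y - f n y| < e.
Proof.
split=> [fg e e0|fg].
  apply: (fg [set h | forall y, A y -> `|g y - h y| < e]).
  apply/uniform_nbhs; exists [set xy : R * R | ball xy.1 e xy.2].
  by split; [exact: entourage_ball (PosNum e0) | move=> h].
move=> P /uniform_nbhs[E [entE EP]].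
have [e e0 eE] : exists2 e : R, 0 < e & [set xy : R * R | ball xy.1 e xy.2] `<=` E.
  by move: entE; rewrite -entourage_ballE => -[e /= e0 eE]; exists e.
apply: filterS (fg e e0) => n fge; apply: EP => y Ay.
by apply: eE; exact: fge.
Qed.

Lemma near_natSinv_le {R : realType} (e : R) : 0 < e ->
  \forall n \near \oo, n.+1%:R^-1 <= e.
Proof.
move=> e0; apply: filterS (near_infty_natSinv_lt (PosNum e0)) => n.
exact: ltW.
Qed.

Section Limit.
Context {R : realType} {d : nat}.
Variable H : 'rV[R]_d -> 'rV[R]_d -> R.
Hypothesis H_well_posed : well_posed H /\ well_posed (oppH H).
Hypothesis H_lax_oleinik : lax_oleinik H.
Hypothesis H_action : independent_of_x H \/ action_condition H.
Variable T : R.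
Implicit Types (u w : 'rV[R]_d -> R) (xi zeta eta rho : R -> R) (ts : seq R).

Notation flow := (flow_along H).

Definition within_dist (delta : R) zeta xi :=
  forall t, 0 <= t <= T -> `|zeta t - xi t| <= delta.

(** The limit of the flows written with a modulus instead of sequences; by
    stability it is the same notion as soon as approximations exist, see
    [flow_limitP]. *)
Definition uniform_flow_limit xi u w := forall e, 0 < e ->
  exists2 delta : R, 0 < delta & forall zeta ts, piecewise_affine T ts zeta ->
    within_dist delta zeta xi -> forall x, `|flow zeta 0 ts u x - w x| <= e.

(** Arbitrarily good piecewise affine approximations of both paths that have
    the same flow. By stability the limits along xi and rho then agree. *)
Definition coupled xi rho := forall delta : R, 0 < delta ->
  exists zeta eta ts1 ts2,
    [/\ piecewise_affine T ts1 zeta, piecewise_affine T ts2 eta,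
        within_dist delta zeta xi, within_dist delta eta rho &
        forall u, BUC u -> flow zeta 0 ts1 u = flow eta 0 ts2 u].

Lemma coupled_sym xi rho : coupled xi rho -> coupled rho xi.
Proof.
move=> cpl delta /cpl[zeta [eta [ts1 [ts2 [h1 h2 h3 h4 h5]]]]].
by exists eta, zeta, ts2, ts1; split=> // u uB; rewrite h5.
Qed.

Lemma within_distC delta zeta xi : within_dist delta zeta xi -> within_dist delta xi zeta.
Proof. by move=> h t /h; rewrite distrC. Qed.

Lemma within_dist_trans a b zeta xi eta : within_dist a zeta xi ->
  within_dist b xi eta -> within_dist (a + b) zeta eta.
Proof.
move=> h1 h2 t tT; rewrite -(subrK (xi t) (zeta t)) -addrA.
by apply: le_trans (ler_normD _ _) _; apply: lerD; [exact: h1 | exact: h2].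
Qed.

Lemma uniform_flow_limit_seq xi u w (zeta : nat -> R -> R) (ts : nat -> seq R) :
    BUC u -> (forall n, piecewise_affine T (ts n) (zeta n)) ->
    (forall n, within_dist n.+1%:R^-1 (zeta n) xi) ->
    (forall e, 0 < e -> \forall n \near \oo, forall x,
       `|w x - flow (zeta n) 0 (ts n) u x| <= e) ->
  uniform_flow_limit xi u w.
Proof.
move=> uB pa close cv e e0; have e2 : 0 < e / 2 by rewrite divr_gt0.
have [r r0 Hr] := flow_stable H_well_posed H_lax_oleinik H_action uB e2.
have r2 : 0 < r / 2 by rewrite divr_gt0.
exists (r / 2) => // eta rs rpa rclose x.
near \oo => n.
have h1 : forall x, `|w x - flow (zeta n) 0 (ts n) u x| <= e / 2.
  by near: n; exact: cv.
have h2 : n.+1%:R^-1 <= r / 2 :> R.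
  by near: n; exact: near_natSinv_le r2.
have close' : within_dist r eta (zeta n).
  move=> t tT; have := within_dist_trans rclose (within_distC (close n)) tT.
  move=> h; apply: le_trans h _.
  by rewrite -lerBrDl; apply: le_trans h2 _; lra.
have := Hr _ _ _ _ _ rpa (pa n) close' x.
have := h1 x; rewrite !ler_norml => /andP[? ?] /andP[? ?]; apply/andP; split; lra.
Unshelve. all: by end_near. Qed.

Lemma approximating_sequence xi rho : coupled xi rho ->
  exists zeta : nat -> R -> R, exists2 ts : nat -> seq R,
    forall n, piecewise_affine T (ts n) (zeta n) &
    forall n, within_dist n.+1%:R^-1 (zeta n) xi.
Proof.
move=> cpl.
have /choice[z Hz] : forall n : nat, exists z : (R -> R) * seq R,
    piecewise_affine T z.2 z.1 /\ within_dist n.+1%:R^-1 z.1 xi.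
  move=> n; have [|zeta [eta [ts1 [ts2 []]]]] := cpl n.+1%:R^-1.
    by rewrite invr_gt0.
  by move=> pa _ close _ _; exists (zeta, ts1).
by exists (fun n => (z n).1), (fun n => (z n).2) => n; have [] := Hz n.
Qed.

Lemma within_dist_cvg (zeta : nat -> R -> R) xi :
    (forall n, within_dist n.+1%:R^-1 (zeta n) xi) ->
  {uniform `[0, T], zeta @ \oo --> xi}.
Proof.
move=> close; apply/uniform_cvgP => e e0; near=> n => t /=; rewrite in_itv/= => tT.
rewrite distrC; apply: le_lt_trans (close n t tT) _.
by near: n; exact: near_infty_natSinv_lt (PosNum e0).
Unshelve. all: by end_near. Qed.

Lemma flow_limitP xi rho u w : coupled xi rho ->
    {within `[0, T], continuous xi} -> BUC u ->
  flow_limit H T xi u w <-> uniform_flow_limit xi u w.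
Proof.
move=> cpl xi_c uB; split.
  move=> [_ lim]; have [zeta [ts pa close]] := approximating_sequence cpl.
  apply: (uniform_flow_limit_seq uB pa close) => e e0.
  have /uniform_cvgP/(_ e e0) := lim _ _ pa (within_dist_cvg close).
  by apply: filterS => n Hn x; apply/ltW/Hn.
move=> lim; split=> // zeta ts pa zeta_xi; apply/uniform_cvgP => e e0.
have e2 : 0 < e / 2 by rewrite divr_gt0.
have [r r0 Hr] := lim _ e2.
move/uniform_cvgP: zeta_xi => /(_ r r0); apply: filterS => n Hn x _.
rewrite distrC; apply: (@le_lt_trans _ _ (e / 2)); last lra.
apply: Hr => // t tT; rewrite distrC; apply/ltW/Hn.
by rewrite /= in_itv.
Qed.

Lemma uniform_flow_limit_exists xi rho u : coupled xi rho -> BUC u ->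
  exists w, uniform_flow_limit xi u w.
Proof.
move=> cpl uB; have [zeta [ts pa close]] := approximating_sequence cpl.
pose F n := flow (zeta n) 0 (ts n) u.
have cauchyF e : 0 < e -> exists N, forall m n, (N <= m)%N -> (N <= n)%N ->
    forall x, `|F m x - F n x| <= e.
  move=> e0; have [r r0 Hr] := flow_stable H_well_posed H_lax_oleinik H_action uB e0.
  have r2 : 0 < r / 2 by rewrite divr_gt0.
  have [N _ HN] := near_natSinv_le r2.
  exists N => m n Nm Nn x; apply: (Hr T) => // t tT.
  have := within_dist_trans (close m) (within_distC (close n)) tT.
  move/le_trans; apply; rewrite [leRHS](splitr r).
  by apply: lerD; [exact: HN m Nm | exact: HN n Nn].
have cvF x : cvg (F n x @[n --> \oo]).
  apply/cauchy_cvgP/cauchy_exP => e e0.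
  have e2 : 0 < e / 2 by rewrite divr_gt0.
  have [N HN] := cauchyF _ e2.
  exists (F N x); exists N => // n /= Nn; rewrite -ball_normE /=.
  by apply: le_lt_trans (HN N n (leqnn _) Nn x) _; lra.
exists (fun x => lim (F n x @[n --> \oo])).
apply: (uniform_flow_limit_seq uB pa close) => e e0.
have e2 : 0 < e / 2 by rewrite divr_gt0.
have [N HN] := cauchyF _ e2.
exists N => // n /= Nn x.
have /cvgrPdist_le /(_ _ e2) near_lim := cvF x.
near \oo => m.
have h1 : `|lim (F n x @[n --> \oo]) - F m x| <= e / 2 by near: m; exact: near_lim.
have h2 : `|F m x - F n x| <= e / 2 by apply: HN => //; near: m; exists N.
rewrite -/(F n) -(subrK (F m x) (lim _)) -addrA.
by apply: le_trans (ler_normD _ _) _; lra.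
Unshelve. all: by end_near. Qed.

Lemma uniform_flow_limit_coupled xi rho u w : coupled xi rho -> BUC u ->
  uniform_flow_limit xi u w -> uniform_flow_limit rho u w.
Proof.
move=> cpl uB lim e e0; have e2 : 0 < e / 2 by rewrite divr_gt0.
have [p p0 Hp] := lim _ e2.
have [r r0 Hr] := flow_stable H_well_posed H_lax_oleinik H_action uB e2.
have r2 : 0 < r / 2 by rewrite divr_gt0.
exists (r / 2) => // zeta ts pa close x.
have [|xi' [rho' [ts1 [ts2 [pa1 pa2 cl1 cl2 eqf]]]]] := cpl (Num.min p (r / 2)).
  by rewrite lt_min p0.
have h1 : `|flow xi' 0 ts1 u x - w x| <= e / 2.
  by apply: Hp => // t /cl1 /le_trans; apply; rewrite ge_min lexx.
have h2 : `|flow zeta 0 ts u x - flow rho' 0 ts2 u x| <= e / 2.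
  apply: (Hr T) => // t tT.
  have := within_dist_trans close (within_distC cl2) tT; move/le_trans; apply.
  have : Num.min p (r / 2) <= r / 2 by rewrite ge_min lexx orbT.
  lra.
rewrite -(subrK (flow rho' 0 ts2 u x) (flow zeta 0 ts u x)) -addrA -{2}eqf//.
by apply: le_trans (ler_normD _ _) _; lra.
Qed.

(** A uniform limit of Lipschitz paths is continuous. *)
Lemma coupled_continuous xi rho : coupled xi rho -> {within `[0, T], continuous rho}.
Proof.
move=> cpl; apply/subspace_continuousP => t /=; rewrite in_itv/= => tT.
apply/cvgrPdist_le => e e0; have e4 : 0 < e / 4 by rewrite divr_gt0.
have [_ [eta [_ [ts [_ pa _ close _]]]]] := cpl _ e4.
have [cts lts] := (piecewise_affineP _ _ _).1 pa.
have [K K0 HK] := affine_cells_lipschitz cts.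
have lip s s' : 0 <= s <= T -> 0 <= s' <= T -> `|eta s - eta s'| <= K * `|s - s'|.
  move=> /andP[s0 sT] /andP[s'0 s'T].
  rewrite -lts in sT s'T; have [ss'|/ltW s's] := leP s s'.
    by rewrite (ler0_norm (_ : s - s' <= 0)) ?subr_le0// opprB; exact: HK.
  by rewrite distrC (ger0_norm (_ : 0 <= s - s')) ?subr_ge0//; exact: HK.
have r0 : 0 < e / 2 / (K + 1) by rewrite divr_gt0 ?divr_gt0// ltr_wpDl.
exists (e / 2 / (K + 1)) => //= s; rewrite in_itv /= => ts_close sT.
have h : K * `|t - s| <= e / 2.
  apply: (@le_trans _ _ ((K + 1) * `|t - s|)); first by rewrite ler_wpM2r// lerDl.
  by rewrite mulrC -ler_pdivlMr ?ltr_wpDl// ltW.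
change (`|rho t - rho s| <= e).
have := le_trans (lip t s tT sT) h; have := close t tT; have := close s sT.
rewrite !ler_norml => /andP[? ?] /andP[? ?] /andP[? ?]; apply/andP; split; lra.
Qed.

Lemma coupled_flow xi rho u : coupled xi rho ->
    {within `[0, T], continuous xi} -> BUC u ->
  [/\ flow_defined H T xi u, flow_defined H T rho u &
      solution_flow H T xi u = solution_flow H T rho u].
Proof.
move=> cpl xi_c uB; have cpl' := coupled_sym cpl; have rho_c := coupled_continuous cpl.
have [w wlim] := uniform_flow_limit_exists cpl uB.
split.
- by exists w; apply/(flow_limitP _ cpl xi_c uB).
- by exists w; apply/(flow_limitP _ cpl' rho_c uB)/(uniform_flow_limit_coupled cpl).
- rewrite /solution_flow; congr (xget _ _); apply/seteqP; split=> v /=.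
    move/(flow_limitP _ cpl xi_c uB) => vlim.
    by apply/(flow_limitP _ cpl' rho_c uB)/(uniform_flow_limit_coupled cpl).
  move/(flow_limitP _ cpl' rho_c uB) => vlim.
  by apply/(flow_limitP _ cpl xi_c uB)/(uniform_flow_limit_coupled cpl').
Qed.

End Limit.

(** * Coupling a path with its reduction *)

Section Coupling.
Context {R : realType} {d : nat}.
Variable H : 'rV[R]_d -> 'rV[R]_d -> R.
Hypothesis H_well_posed : well_posed H /\ well_posed (oppH H).
Hypothesis H_lax_oleinik : lax_oleinik H.
Implicit Types (u : 'rV[R]_d -> R) (s a b : R) (ts : seq R).

Notation flow := (flow_along H).

(** When the end values are equal the path is constant on the nodes, so either
    order may be used. *)
Lemma flow_between xi s ts u : BUC u ->
    {in s :: ts, forall t, between (xi s) (xi (last s ts)) (xi t)} ->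
  flow xi s ts u = semigroup H (xi (last s ts) - xi s) u.
Proof.
move=> uB range; have [le_s|lt_s] := leP (xi s) (xi (last s ts)).
  apply: flow_from_min_to_max => // t /range /orP[//|/andP[? ?]].
  by apply/andP; split; lra.
apply: flow_from_max_to_min => // t /range /orP[/andP[? ?]|//].
by apply/andP; split; lra.
Qed.

Variables (T : R) (xi : R -> R).
Hypothesis T_gt0 : 0 < T.
Hypothesis xi_continuous : {within `[0, T], continuous xi}.

(** On such a cell the chord of xi can be replaced by a fine interpolation of
    xi, without changing the flow. *)
Definition refinable (delta a b : R) := exists ts,
  [/\ last a ts = b, cells (chord_close xi xi delta) a ts &
      {in a :: ts, forall t, between (xi a) (xi b) (xi t)}].

Lemma between_ends (a b : R) : between a b a /\ between a b b.
Proof. by rewrite /between !lexx /= !andbT !le_total. Qed.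

Lemma refinable_single delta a b : chord_close xi xi delta a b ->
  refinable delta a b.
Proof.
move=> close; exists [:: b]; split=> // t.
have [ha hb] := between_ends (xi a) (xi b).
by rewrite !inE => /orP[]/eqP ->.
Qed.

Lemma refinable_between delta a b : 0 < delta -> 0 <= a -> a <= b -> b <= T ->
    (forall t, a <= t <= b -> between (xi a) (xi b) (xi t)) ->
  refinable delta a b.
Proof.
move=> delta0 a0 ab bT range.
have [r r0 Hr] := uniformly_continuous_segment xi_continuous delta0.
have r2 : 0 < r / 2 by rewrite divr_gt0.
have [ts lts cts] := fine_partition r2 ab.
have cts' : sorted_from a ts by apply: sub_cells cts => ? ? /andP[].
exists ts; split=> // [|t tin]; last first.
  by apply: range; rewrite -lts; exact: cells_le_last cts' _ tin.
have lT : last a ts <= T by rewrite lts.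
elim: ts a a0 {ab range lts} cts cts' lT => //= y ts IH x x0 [/andP[xy yr] cts] [_ cts'] lT.
have yl : y <= last y ts.
  by have /andP[] := cells_le_last (fun _ _ => id) cts' (mem_head _ _).
split; last by apply: IH => //; exact: le_trans xy.
split=> // t /andP[xt ty].
have inT s : x <= s -> s <= y -> 0 <= s <= T.
  by move=> xs sy; rewrite (le_trans x0)// (le_trans sy)// (le_trans yl).
have hx : `|xi x - xi t| < delta.
  by apply: Hr; rewrite ?inT// distrC ger0_norm; lra.
have hy : `|xi y - xi t| < delta.
  by apply: Hr; rewrite ?inT// ger0_norm; lra.
have xty : x <= t <= y by rewrite xt.
move: hx hy (chord_between xi xty); rewrite !ltr_norml => /andP[? ?] /andP[? ?].
by move=> /orP[] /andP[? ?]; rewrite ler_norml; apply/andP; split; lra.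
Qed.

Lemma refine_cells delta s ts : cells (refinable delta) s ts ->
  exists rs, [/\ last s rs = last s ts, cells (chord_close xi xi delta) s rs &
    forall u, BUC u -> flow xi s rs u = flow xi s ts u].
Proof.
elim: ts s => [|t ts IH] s /=; first by exists [::].
move=> [[bs [lbs cbs range]] /IH[rs [lrs crs Hrs]]].
exists (bs ++ rs); rewrite last_cat lbs; split=> //.
  by apply/cells_cat; rewrite lbs.
move=> u uB; rewrite flow_cat lbs (@flow_between xi s bs) ?lbs// Hrs//.
exact: BUC_semigroup.
Qed.

Lemma cells_map_iota (P : R -> R -> Prop) (f : nat -> R) :
  (forall k, P (f k) (f k.+1)) -> forall n k,
  cells P (f k) [seq f i | i <- iota k.+1 n] /\
  last (f k) [seq f i | i <- iota k.+1 n] = f (k + n)%N.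
Proof.
move=> Pf; elim=> [|n IH] k /=; first by rewrite addn0.
by have [h1 h2] := IH k.+1; rewrite addnS -addSn.
Qed.

(** Interpolate xi at the given nodes to approximate rho, and at a refinement
    of them to approximate xi itself. *)
Lemma coupled_of_nodes rho :
    (forall delta, 0 < delta -> exists ts, [/\ last 0 ts = T,
      cells (refinable delta) 0 ts, sorted_from 0 ts &
      cells (chord_close xi rho delta) 0 ts]) ->
  coupled H T xi rho.
Proof.
move=> nodes delta /nodes[ts [lts rts sts cts]].
have [rs [lrs crs Hrs]] := refine_cells rts.
have srs : sorted_from 0 rs by apply: sub_cells crs => ? ? [].
have nonempty vs : last 0 vs = T -> (0 < size vs)%N.
  by case: vs => //= T0; move: T_gt0; rewrite -T0 ltxx.
exists (interpolate xi 0 rs), (interpolate xi 0 ts), rs, ts; split.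
- by apply/piecewise_affineP; rewrite lrs; split=> //; exact: interpolate_affine.
- by apply/piecewise_affineP; split=> //; exact: interpolate_affine.
- move=> t tT; apply: interpolate_close => //; first by apply: nonempty; rewrite lrs.
  by rewrite lrs lts.
- move=> t tT; apply: interpolate_close => //; first exact: nonempty.
  by rewrite lts.
- move=> u uB; rewrite (@eq_flow _ _ H (interpolate xi 0 rs) xi)//; last first.
    exact: interpolate_node.
  rewrite (@eq_flow _ _ H (interpolate xi 0 ts) xi)//; last exact: interpolate_node.
  exact: Hrs.
Qed.

Notation tau := (tau T xi).

Lemma chord_close_between (rho : R -> R) (p q delta a b : R) : a <= b ->
    `|p - q| <= delta ->
    (forall t, a <= t <= b -> between p q (xi t)) ->
    (forall t, a <= t <= b -> between p q (rho t)) ->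
  chord_close xi rho delta a b.
Proof.
move=> ab pq hxi hrho; split=> // t tab; apply: le_trans pq.
apply: between_dist; last exact: hrho.
apply: between_trans (chord_between xi tab); apply: hxi;
  by rewrite lexx ab.
Qed.

(** Take the nodes 0, tau_(-m), ..., tau_n, T, with m and n so large that xi
    oscillates by at most delta before tau_(-m) and after tau_n. On the inner
    cells the reduced path is the chord and xi stays between its end values;
    on the two outer cells every path involved is delta-close to the chord. *)
Lemma coupled_reduced_path : coupled H T xi (reduced_path T xi).
Proof.
have T_ge0 := ltW T_gt0.
apply: coupled_of_nodes => delta delta0.
have [n small_n] := small_tail T_ge0 xi_continuous delta0.
have [m small_m] := small_head T_ge0 xi_continuous delta0.
pose f (k : nat) := tau (k%:Z - m%:Z).
have f0 : f 0%N = tau (- m%:Z) by rewrite /f sub0r.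
have fmn : f (0 + (m + n))%N = tau n%:Z by rewrite /f add0n PoszD addrAC subrr add0r.
have fS k : f k.+1 = tau (k%:Z - m%:Z + 1) by rewrite /f intS -addrA addrC.
have in_T := tau_segment T_ge0 xi_continuous.
pose P a b := [/\ refinable delta a b, a <= b &
  chord_close xi (reduced_path T xi) delta a b].
have P_in k : P (f k) (f k.+1).
  rewrite fS /f; set i := _ - _.
  have ii := tau_leS T_ge0 xi_continuous i.
  have /andP[i0 _] := in_T i; have /andP[_ iT] := in_T (i + 1).
  split=> //; first by apply: refinable_between => // t; exact: tau_between.
  split=> // t ti; rewrite (reduced_path_chord T_ge0 xi_continuous ti).
  by rewrite subrr normr0 ltW.
have P_head : P 0 (f 0%N).
  rewrite f0; have /andP[m0 _] := in_T (- m%:Z); split=> //.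
    apply: refinable_single; apply: chord_close_between small_m _ _ => // t;
      exact: head_between.
  apply: chord_close_between small_m _ _ => // t; first exact: head_between.
  exact: reduced_path_head.
have P_tail : P (f (0 + (m + n))%N) T.
  rewrite fmn; have /andP[_ nT] := in_T n%:Z; split=> //.
    apply: refinable_single; apply: chord_close_between small_n _ _ => // t;
      exact: tail_between.
  apply: chord_close_between small_n _ _ => // t; first exact: tail_between.
  exact: reduced_path_tail.
have [cells_in last_in] := cells_map_iota P_in (m + n) 0.
pose ts := (f 0%N :: [seq f i | i <- iota 1 (m + n)]) ++ [:: T].
have cts : cells P 0 ts by apply/cells_cat; rewrite /= last_in.
exists ts; split; first by rewrite last_cat.
- by apply: sub_cells cts => ? ? [].
- by apply: sub_cells cts => ? ? [].
- by apply: sub_cells cts => ? ? [].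
Qed.

End Coupling.

Theorem theorem2p9 (R : realType) (d : nat)
    (H : 'rV[R]_d -> 'rV[R]_d -> R)
    (Hconvex : convex_in_p H)
    (Hlipschitz : lipschitz_in_p H)
    (Hwell_posed : well_posed H /\ well_posed (oppH H))
    (Hlax_oleinik : lax_oleinik H)
    (Haction : independent_of_x H \/ action_condition H)
    (T : R) (T_gt0 : 0 < T)
    (xi : R -> R) (xi_continuous : {within `[0, T], continuous xi})
    (xi0 : xi 0 = 0) :
  forall u0 : 'rV[R]_d -> R, BUC u0 ->
    [/\ flow_defined H T xi u0,
        flow_defined H T (reduced_path T xi) u0 &
        solution_flow H T xi u0 = solution_flow H T (reduced_path T xi) u0].
Proof.
move=> u0 u0B; apply: coupled_flow => //.
exact: coupled_reduced_path.
Qed.
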